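(* Assume that: (i) the function $\phi$ is bounded; (ii) the function $\psi(x):=\mathbb{E}[\phi(f(x,\Theta))]$ is globally Lipschitz continuous on $\mathbb{R}^d$; (iii) $\mathbb{E}[|X|^2]<+\infty$, where $X\sim\mu_X$; (iv) there exists an integer $m_0\ge1$ such that $\mathbb{E}\left[\min_{1\le j\le m_0}|X'_j|\right]<+\infty$; (v) there exists an open set $U\subset\mathbb{R}^d$ containing $\operatorname{supp}(\mu_X)$ such that: the measure $\mu_{X'}(\cdot\cap U)$ has a density $p_{X'}$ with respect to the Lebesgue measure; $p_{X'}$ is continuous and positive on $U$; and there exist $\kappa\in(0,1]$ and $r_\kappa>0$ such that for any $x\in U$ and any $r\in[0,r_\kappa]$, $\mu_{X'}(B(x,r))\ge\kappa\,p_{X'}(x)\,v_d\,r^d$; (vi) $\mathbb{E}\left[\dfrac{1+|X|^2}{p_{X'}(X)^{2/d}}\right]<+\infty$. Let $(k_m)_{m\ge1}$ be a nondecreasing sequence of positive integers with $k_m\le m$ and $k_m\sim m^{2/(d+2)}$ as $m\to+\infty$. Then, as $m,n\to+\infty$, $$\mathbb{E}\left[\left|\mathrm{QI}-\widehat{\mathrm{QI}}_{m,n}^{(k_m)}\right|^2\right]^{1/2}=\mathrm{O}\left(\frac1{\sqrt n}+\tau_{1,d}(n)\right)+\mathrm{O}\left(\frac{1}{m^{1/(d+2)}}\right),$$ where the first $\mathrm{O}$ is uniform in $m$ and the second is uniform in $n$.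
   Context: $|\cdot|$ is a fixed norm on $\mathbb{R}^d$ (not necessarily Euclidean), $B(x,r)=\{x':|x-x'|\le r\}$, $v_d$ is the Lebesgue volume of the unit ball of $|\cdot|$. $\mathbf{\Theta}$ is a measurable space, $f:\mathbb{R}^d\times\mathbf{\Theta}\to\mathbb{R}^e$ and $\phi:\mathbb{R}^e\to\mathbb{R}$ are measurable. $\mu_X,\mu_{X'}$ are probability measures on $\mathbb{R}^d$ and $\mu_\Theta$ a probability measure on $\mathbf{\Theta}$. $X\sim\mu_X$ and $\Theta\sim\mu_\Theta$ are independent, $Y=f(X,\Theta)$, and $\mathrm{QI}=\mathbb{E}[\phi(Y)]$. $(X_i)_{i\ge1}$ are i.i.d. with law $\mu_X$, $(X'_j)_{j\ge1}$ are i.i.d. with law $\mu_{X'}$, $(\Theta_j)_{j\ge1}$ are i.i.d. with law $\mu_\Theta$, and these three sequences are independent; $Y'_j=f(X'_j,\Theta_j)$. $\operatorname{supp}(\nu)=\{x\in\mathbb{R}^d:\forall r>0,\ \nu(B(x,r))>0\}$. The $k$-NN estimator is, for $k\in\{1,\dots,m\}$, $$\widehat{\mathrm{QI}}_{m,n}^{(k)}=\frac1m\sum_{j=1}^m w^{(k)}_j\phi(Y'_j),\qquad w^{(k)}_j:=\frac{m}{kn}\sum_{i=1}^n\sum_{l=1}^k\mathbf{1}_{\{j=j^{(l)}(X_i)\}},$$ where, for $x\in\mathbb{R}^d$, the indices $1,\dots,m$ are ordered by increasing distance $|x-X'_j|$, ties broken by lowest index, and $j^{(l)}(x)$ is the $l$-th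 index in this order (so $(j^{(l)}(x))_{1\le l\le m}$ is a permutation of $\{1,\dots,m\}$). $W_1(\mu,\nu)=\inf\{\int|x-x'|\,d\gamma(x,x'):\gamma\in\Pi(\mu,\nu)\}$, with $\Pi(\mu,\nu)$ the set of couplings of $\mu$ and $\nu$; $\hat{\mu}_{\mathbf{X}_n}:=\frac1n\sum_{i=1}^n\delta_{X_i}$; and $(\tau_{1,d}(n))_{n\ge1}$ denotes any nonnegative sequence such that $\mathbb{E}[W_1(\mu_X,\hat{\mu}_{\mathbf{X}_n})]=\mathrm{O}(\tau_{1,d}(n))$ as $n\to+\infty$. *)

(* Defs.v *)
From HB Require Import structures.
From mathcomp Require Import all_boot all_order all_algebra.
From mathcomp Require Import all_classical all_reals all_analysis.
From mathcomp Require Import measurable_realfun.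

Set Implicit Arguments.
Unset Strict Implicit.
Unset Printing Implicit Defensive.

Import Order.TTheory GRing.Theory Num.Theory.
Import numFieldNormedType.Exports.

Local Open Scope classical_set_scope.
Local Open Scope ring_scope.

(* Matrices carry the Borel sigma-algebra, so 'rV[R]_d is R^d as a measurable *)
(* space.                                                                     *)
Section borel_matrix.
Context (R : realType) (m n : nat).

Let mx_set0 : <<s @open 'M[R]_(m, n) >> set0.
Proof. exact: sigma_algebra0. Qed.

Let mx_setC A : <<s @open 'M[R]_(m, n) >> A -> <<s @open 'M[R]_(m, n) >> (~` A).
Proof. exact: sigma_algebraC. Qed.

Let mx_bigcup (F : (set 'M[R]_(m, n))^nat) :
  (forall i, <<s @open 'M[R]_(m, n) >> (F i)) ->
  <<s @open 'M[R]_(m, n) >> (\bigcup_i F i).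
Proof. exact: sigma_algebra_bigcup. Qed.

HB.instance Definition _ := @isMeasurable.Build (sigma_display (@open 'M[R]_(m, n)))
  'M[R]_(m, n) <<s @open 'M[R]_(m, n) >> mx_set0 mx_setC mx_bigcup.

End borel_matrix.

(* Lebesgue measure on R^n is the n-fold product of the one-dimensional one,  *)
(* built on tuples (zero-dimensional case: a point mass) and transported to   *)
(* row vectors; see lebesgue_rV_box.                                          *)
Section lebesgue_rV.
Context (R : realType).

Definition row_of_tuple n (t : n.-tuple R) : 'rV[R]_n := \row_i tnth t i.

Lemma measurable_row_of_tuple n : measurable_fun setT (@row_of_tuple n).
Proof.
apply: (measurability (@open 'rV[R]_n)) => // _ [U oU <-].
rewrite setTI.
pose box (q : 'rV[rat]_n) (k : nat) : set 'rV[R]_n :=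
  [set v | forall i, `|v ord0 i - ratr (q ord0 i)| < k.+1%:R^-1].
pose F (qk : 'rV[rat]_n * nat) : set 'rV[R]_n :=
  if `[< box qk.1 qk.2 `<=` U >] then box qk.1 qk.2 else set0.
have -> : U = \bigcup_(qk in [set: 'rV[rat]_n * nat]) F qk.
  apply/seteqP; split => [x Ux|x [qk _]]; last first.
    by rewrite /F; case: asboolP => // bU; exact: bU.
  have /nbhs_ballP[e /= e0 xeU] : nbhs x U by exact: open_nbhs_nbhs.
  have /ltr_add_invr[k] : 0 < e / 2 :> R by rewrite divr_gt0.
  rewrite add0r => ke.
  have k0 : 0 < k.+1%:R^-1 :> R by rewrite invr_gt0.
  have qP i : exists q : rat, `|x ord0 i - ratr q| < k.+1%:R^-1.
    have /rat_in_itvoo[q qx] : x ord0 i - k.+1%:R^-1 < x ord0 i + k.+1%:R^-1.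
      by rewrite ltrBlDr -addrA ltrDl addr_gt0.
    exists q; move: qx; rewrite in_itv/= => /andP[q1 q2].
    by rewrite distrC ltr_distl q1.
  exists (\row_i sval (cid (qP i)), k) => //; rewrite /F/=.
  have bx : box (\row_i sval (cid (qP i))) k x.
    by move=> i; rewrite mxE; exact: svalP (cid (qP i)).
  case: asboolP => [//|nbU]; exfalso; apply: nbU => y ybox; apply: xeU; split => // i j.
  rewrite ord1 /ball/= -(subrK (ratr ((\row_i sval (cid (qP i))) ord0 j)) (x _ _)).
  rewrite -addrA (le_lt_trans (ler_normD _ _))// [e]splitr ltrD//.
    by rewrite (lt_trans _ ke)//; exact: bx.
  by rewrite (lt_trans _ ke)// distrC; exact: ybox.
rewrite preimage_bigcup; apply: countable_bigcupT_measurable => // -[q k].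
rewrite /F/=; case: asboolP => [bU|_]; last by rewrite preimage_set0.
rewrite (_ : _ @^-1` _ = \bigcap_(i in [set: 'I_n])
   [set t : n.-tuple R | `|tnth t i - ratr (q ord0 i)| < k.+1%:R^-1]); last first.
  apply/seteqP; split => t /= tb i; first by move=> _; have := tb i; rewrite mxE.
  by rewrite mxE; exact: tb.
apply: fin_bigcap_measurable => // i _.
rewrite -[X in measurable X]setTI.
have mt : measurable_fun [set: n.-tuple R]
    (fun t => `|tnth t i - ratr (q ord0 i)|).
  apply: measurableT_comp => //; apply: measurable_funB => //.
  exact: measurable_tnth.
have := mt measurableT _ (measurable_itv `]-oo, k.+1%:R^-1[).
by congr measurable; apply/seteqP; split => t; rewrite /= in_itv.
Qed.

Definition cons_tuple n (xt : R * n.-tuple R) : n.+1.-tuple R :=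
  [tuple of xt.1 :: xt.2].

Lemma measurable_cons_tuple n : measurable_fun setT (@cons_tuple n).
Proof. exact: measurable_cons. Qed.

Section lebesgue_cons.
Context (n : nat) (mu : {sigma_finite_measure set (n.-tuple R) -> \bar R}).

Definition lebesgue_cons : set (n.+1.-tuple R) -> \bar R :=
  pushforward (lebesgue_measure \x mu)%E (@cons_tuple n).

(* pushforward is a measure only given a measurability proof, which canonical *)
(* inference cannot supply: hence the explicit instances below.               *)
HB.instance Definition _ := Measure.copy lebesgue_cons
  (measure_function_pushforward__canonical__measure_function_Measure
    (lebesgue_measure \x mu)%E (@measurable_cons_tuple n)).

Let lebesgue_cons_sigma_finite : sigma_finite setT lebesgue_cons.
Proof.
have /sigma_finiteP[F [TF ndF Foo]] := sigma_finiteT (@lebesgue_measure R).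
have /sigma_finiteP[G [TG ndG Goo]] := sigma_finiteT mu.
pose uncons (t : n.+1.-tuple R) : R * n.-tuple R :=
  (thead t, [tuple of behead t]).
have consK (x : R * n.-tuple R) : uncons (cons_tuple x) = x.
  by case: x => x t; congr pair; apply/val_inj.
have mg : measurable_fun setT uncons.
  apply/measurable_fun_pairP; split; last exact: measurable_behead.
  exact: measurable_tnth.
exists (fun k => uncons @^-1` (F k `*` G k)) => [|k].
  apply/esym/seteqP; split => // t _.
  have [k _ Fk] : (\bigcup_k F k) (uncons t).1 by rewrite -TF.
  have [l _ Gl] : (\bigcup_l G l) (uncons t).2 by rewrite -TG.
  exists (maxn k l) => //; split.
    by move: (uncons t).1 Fk; exact/subsetPset/ndF/leq_maxl.
  by move: (uncons t).2 Gl; exact/subsetPset/ndG/leq_maxr.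
have [mF Fk] := Foo k; have [mG Gk] := Goo k; split.
  by rewrite -[X in measurable X]setTI; apply: mg => //; exact: measurableX.
rewrite /lebesgue_cons /pushforward (_ : _ @^-1` _ = F k `*` G k).
  by rewrite product_measure1E// lte_mul_pinfty// ge0_fin_numE.
rewrite -comp_preimage (_ : _ \o _ = idfun) ?preimage_id//.
exact/funext/consK.
Qed.

HB.instance Definition _ := Measure_isSigmaFinite.Build _ _ _ lebesgue_cons
  lebesgue_cons_sigma_finite.

End lebesgue_cons.

Fixpoint lebesgue_tuple n : {sigma_finite_measure set (n.-tuple R) -> \bar R} :=
  if n is m.+1 then lebesgue_cons (lebesgue_tuple m) else \d_[tuple].

Definition lebesgue_rV n : set 'rV[R]_n -> \bar R :=
  pushforward (lebesgue_tuple n) (@row_of_tuple n).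
Arguments lebesgue_rV : clear implicits.

HB.instance Definition _ n := Measure.copy (lebesgue_rV n)
  (measure_function_pushforward__canonical__measure_function_Measure
    (lebesgue_tuple n) (@measurable_row_of_tuple n)).

Let measurable_tuple_box n (B : 'I_n -> set R) :
  (forall i, measurable (B i)) ->
  measurable [set t : n.-tuple R | forall i, B i (tnth t i)].
Proof.
move=> mB; rewrite (_ : [set _ | _] =
    \bigcap_(i in [set: 'I_n]) (fun t => tnth t i) @^-1` B i).
  apply: fin_bigcap_measurable => // i _.
  by rewrite -[X in measurable X]setTI; exact: measurable_tnth.
by apply/seteqP; split => t /= tB i; [move=> _|]; exact: tB.
Qed.

Let lebesgue_tuple_box n (B : 'I_n -> set R) :
  (forall i, measurable (B i)) ->
  lebesgue_tuple n [set t | forall i, B i (tnth t i)] =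
  (\prod_(i < n) lebesgue_measure (B i))%E.
Proof.
elim: n B => [|n IHn] B mB.
  by rewrite big_ord0 /= diracE mem_set//= => -[].
rewrite big_ord_recl -IHn// -product_measure1E//; last first.
- exact: (@measurable_tuple_box _ (fun i => B (lift ord0 i))).
- exact: mB.
congr (product_measure1 _ _ _); apply/seteqP; split => -[x t] /= xtB.
  by split=> [|i]; [exact: (xtB ord0)|have := xtB (lift ord0 i); rewrite tnthS].
move=> i; case: (unliftP ord0 i) => [j ->|->]; last exact: xtB.1.
by rewrite tnthS; exact: xtB.2.
Qed.

Lemma lebesgue_rV_box n (B : 'I_n -> set R) : (forall i, measurable (B i)) ->
  lebesgue_rV n [set v | forall i, B i (v ord0 i)] =
  (\prod_(i < n) lebesgue_measure (B i))%E.
Proof.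
move=> mB; rewrite -lebesgue_tuple_box// /lebesgue_rV /pushforward.
by congr (lebesgue_tuple n _); apply/seteqP; split => t /= tB i;
  have := tB i; rewrite mxE.
Qed.

End lebesgue_rV.
Arguments lebesgue_rV : clear implicits.

Record is_norm (R : realType) (d : nat) (N : 'rV[R]_d -> R) : Prop := IsNorm {
  is_normD : forall x y, N (x + y) <= N x + N y ;
  is_normZ : forall (a : R) x, N (a *: x) = `|a| * N x ;
  is_norm_eq0 : forall x, N x = 0 -> x = 0 }.

Section norm_geometry.
Context (R : realType) (d : nat) (N : 'rV[R]_d -> R).

Definition cball (x : 'rV[R]_d) (r : R) : set 'rV[R]_d :=
  [set y | N (x - y) <= r].

Definition unit_ball_volume : R := fine (lebesgue_rV R d (cball 0 1)).

Definition supp (nu : set 'rV[R]_d -> \bar R) : set 'rV[R]_d :=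
  [set x | forall r, 0 < r -> (0 < nu (cball x r))%E].

Definition coupling (mu nu : set 'rV[R]_d -> \bar R) :
    set (probability ('rV[R]_d * 'rV[R]_d)%type R) :=
  [set g | forall A, measurable A ->
    g (A `*` setT) = mu A /\ g (setT `*` A) = nu A].

Definition W1 (mu nu : set 'rV[R]_d -> \bar R) : \bar R :=
  ereal_inf [set (\int[g]_z (N (z.1 - z.2))%:E)%E | g in coupling mu nu].

End norm_geometry.

Definition empirical (R : realType) (d n : nat) (x : nat -> 'rV[R]_d) :
    {measure set 'rV[R]_d -> \bar R} :=
  mscale (n%:R^-1)%:nng (msum (fun i => \d_(x i)) n).

Definition is_density d (T : measurableType d) (R : realType)
    (mu nu : set T -> \bar R) (p : T -> R) :=
  [/\ measurable_fun setT p, (forall x, 0 <= p x) &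
      forall A, measurable A -> nu A = (\int[mu]_(x in A) (p x)%:E)%E].

Section independence.
Context d (T : measurableType d) (R : realType) (P : probability T R).

Definition mutually_independent (I : choiceType) (F : I -> set_system T) :=
  forall (s : seq I) (A : I -> set T), uniq s ->
    (forall i, i \in s -> F i (A i)) ->
    P (\bigcap_(i in [set` s]) A i) = (\prod_(i <- s) P (A i))%E.

Context d' (T' : measurableType d').

Definition sigma_rv (X : {RV P >-> T'}) : set_system T :=
  preimage_set_system setT X measurable.

Definition sigma_rv_seq (X : nat -> {RV P >-> T'}) : set_system T :=
  <<s \bigcup_i sigma_rv (X i) >>.

Definition has_law (X : {RV P >-> T'}) (mu : set T' -> \bar R) :=
  forall A, measurable A -> distribution P X A = mu A.

Definition iid (X : nat -> {RV P >-> T'}) (mu : set T' -> \bar R) :=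
  (forall i, has_law (X i) mu) /\
  mutually_independent (fun i => sigma_rv (X i)).

End independence.

(* All indices start at 0: the points are x' 0, ..., x' (m - 1), and          *)
(* nn_index x' m x l is the index of the (l+1)-th nearest to x among them.    *)
Section nearest_neighbours.
Context (R : realType) (d : nat) (N : 'rV[R]_d -> R).

Definition nn_order (x' : nat -> 'rV[R]_d) (x : 'rV[R]_d) : rel nat :=
  fun i j => (N (x - x' i) < N (x - x' j)) ||
             ((N (x - x' i) == N (x - x' j)) && (i <= j)%N).

Definition nn_index (x' : nat -> 'rV[R]_d) (m : nat) (x : 'rV[R]_d)
    (l : nat) : nat :=
  nth 0%N (sort (nn_order x' x) (iota 0 m)) l.

Definition nn_weight (x x' : nat -> 'rV[R]_d) (m n k j : nat) : R :=
  m%:R / (k * n)%:R *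
  \sum_(i < n) \sum_(l < k) (j == nn_index x' m (x i) l)%:R.

Definition nn_estimator (x x' : nat -> 'rV[R]_d) (z : nat -> R)
    (m n k : nat) : R :=
  m%:R^-1 * \sum_(j < m) nn_weight x x' m n k j * z j.

End nearest_neighbours.

(* Main.v *)
(** Let [psi x = E[phi (f x Theta)]] and split [QI - QIhat] into [A + B + C],
    where [A = QI - (1/n) sum_i psi (X_i)], [C] is the weighted sum of the
    centred variables [psi (X'_j) - phi (Y'_j)] with weights [w_j / m], and [B]
    is the bias left by replacing [X_i] with its neighbours.  The summands of
    [A] and of [C] are orthogonal, and since [0 <= w_j / m <= 1/k] with total
    mass 1, [E[A^2] = O(1/n)] and [E[C^2] = O(1/k)].

    By Jensen and the Lipschitz property, [B^2] is at most a constant times the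
    average of [|X_i - X'_j|^2] over the [k] neighbours [X'_j] of [X_i].  Cut
    the [m] sample points into [k] groups of [q = m / k]: the nearest points of
    the groups are [k] distinct points, so this average is at most the average
    over groups of the squared distance [Z] to the nearest point of the group.
    For fixed [x] in [U], [P(Z > s) <= (a / s)^2] for every [s > 0], with
    [a = O((1 + |x|^2) p(x)^(-2/d) q^(-2/d))]: for small [s] this is the lower
    bound on balls, and for large [s] the moment hypothesis on
    [min_j |X'_j|] supplies the decay in [s].  Hence [E[Z] <= 3 a], and
    integrating over [X] gives [E[B^2] = O((k/m)^(2/d))]. *)

Require Import Defs.
From HB Require Import structures.
From mathcomp Require Import all_boot all_order all_algebra.
From mathcomp Require Import all_classical all_reals all_analysis.
From mathcomp Require Import measurable_realfun.
From mathcomp Require Import ring lra zify.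

Set Implicit Arguments.
Unset Strict Implicit.
Unset Printing Implicit Defensive.

Import Order.TTheory GRing.Theory Num.Theory.
Import numFieldNormedType.Exports.

Local Open Scope classical_set_scope.
Local Open Scope ring_scope.

(** * Norms and measurability on row vectors *)

Section norms.
Context (R : realType) (d : nat) (N : 'rV[R]_d -> R) (normN : is_norm N).

Let ND := is_normD normN.
Let NZ := is_normZ normN.

Lemma is_norm0 : N 0 = 0.
Proof. by rewrite -(scale0r 0) NZ normr0 mul0r. Qed.

Lemma is_normN x : N (- x) = N x.
Proof. by rewrite -scaleN1r NZ normrN1 mul1r. Qed.

Lemma is_norm_ge0 x : 0 <= N x.
Proof. by have := ND x (- x); rewrite subrr is_norm0 is_normN; lra. Qed.

Lemma is_normB x y : N (x - y) = N (y - x).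
Proof. by rewrite -opprB is_normN. Qed.

Lemma is_normB_triangle z x y : N (x - y) <= N (x - z) + N (z - y).
Proof. by apply: le_trans (ND _ _); rewrite addrA subrK. Qed.

Lemma is_norm_sum (I : Type) (s : seq I) (F : I -> 'rV[R]_d) :
  N (\sum_(i <- s) F i) <= \sum_(i <- s) N (F i).
Proof.
elim/big_ind2 : _ => [|x1 x2 y1 y2 h1 h2|//]; first by rewrite is_norm0.
by rewrite (le_trans (ND _ _))// lerD.
Qed.

Lemma coord_le_norm (x : 'rV[R]_d) i : `|x ord0 i| <= `|x|.
Proof.
rewrite [leRHS]/Num.Def.normr /= mx_normrE; apply/bigmax_geP; right => /=.
by exists (ord0, i).
Qed.

(** Expanding [x] in the canonical basis bounds [N x] by the sup norm times the sum of the norms of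
    the basis vectors. The extra 1 keeps [K] positive in every dimension. *)
Lemma is_norm_upper : exists2 K : R, 0 < K & forall x, N x <= K * `|x|.
Proof.
exists (1 + \sum_(i < d) N (delta_mx 0 i)).
  by rewrite ltr_pwDl// sumr_ge0// => i _; exact: is_norm_ge0.
move=> x; rewrite {1}(row_sum_delta x); apply: (le_trans (is_norm_sum _ _)).
rewrite mulrDl mul1r (le_trans (_ : _ <= (\sum_(i < d) N (delta_mx 0 i)) * `|x|))//.
  rewrite mulr_suml; apply: ler_sum => i _; rewrite NZ mulrC.
  by rewrite ler_wpM2l ?is_norm_ge0// coord_le_norm.
by rewrite lerDr.
Qed.

Lemma is_norm_continuous : continuous N.
Proof.
have [K K0 NK] := is_norm_upper.
move=> x; apply/(@cvgrPdist_lt _ R^o _ (nbhs x)) => e e0.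
near=> y.
have h : `|N x - N y| <= N (x - y).
  rewrite ler_norml; apply/andP; split.
    by have := is_normB_triangle x y 0; rewrite !subr0 (is_normB y); lra.
  by have := is_normB_triangle y x 0; rewrite !subr0; lra.
rewrite (le_lt_trans h)// (le_lt_trans (NK _))// mulrC -ltr_pdivlMr//.
near: y; apply/nbhs_ballP; exists (e / K); first by rewrite /= divr_gt0.
by move=> y; rewrite -ball_normE.
Unshelve. all: by end_near. Qed.

(** The continuous function [N] attains its minimum on the compact unit sphere of the sup norm, and
    this minimum is positive because [N] vanishes only at 0; homogeneity does the rest. *)
Lemma is_norm_lower : exists2 c : R, 0 < c & forall x, c * `|x| <= N x.
Proof.
pose S := [set x : 'rV[R]_d | `|x| = 1].
have [[x0 Sx0]|nS] := pselect (S !=set0); last first.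
  (* An empty sphere means that 0 is the only vector. *)
  exists 1 => // x; suff -> : x = 0 by rewrite normr0 mulr0 is_norm0.
  apply: contrapT => /eqP x0; apply: nS; exists (`|x|^-1 *: x); rewrite /S/=.
  by rewrite normrZ normfV normr_id mulVf// normr_eq0.
have cS : compact S.
  apply: bounded_closed_compact.
    by exists 1; split => // M M1 x /= ->; rewrite ltW.
  rewrite (_ : S = [set x | `|x| \in [set 1 : R]]); last first.
    by apply/seteqP; split => x; rewrite /S/= inE.
  rewrite (_ : [set x | _] = (fun x : 'rV[R]_d => `|x|) @^-1` [set 1 : R]); last first.
    by apply/seteqP; split => x; rewrite /S/= inE.
  apply: closed_comp; last exact: closed_eq.
  by move=> x _; exact: norm_continuous.
have NS : {within S, continuous N}.
  by apply: continuous_subspaceT; exact: is_norm_continuous.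
have [|c] := @EVT_min_rV R d N S _ cS NS; first by exists x0.
rewrite inE => Sc cmin.
have c0 : c != 0.
  apply/eqP => c0; move: Sc; rewrite /S/= c0 normr0 => /esym/eqP.
  by rewrite oner_eq0.
have Nc : 0 < N c.
  rewrite lt_neqAle is_norm_ge0 andbT eq_sym; apply: contra c0.
  by move=> /eqP /(is_norm_eq0 normN) ->.
exists (N c) => // x; have [->|x0'] := eqVneq x 0.
  by rewrite normr0 mulr0 is_norm0.
have xgt0 : 0 < `|x| by rewrite normr_gt0.
have := cmin (`|x|^-1 *: x); rewrite inE/= /S/= normrZ normfV normr_id mulVf ?normr_eq0//.
move=> /(_ erefl); rewrite NZ normfV normr_id mulrC.
by rewrite ler_pdivlMr.
Qed.

End norms.

Section measurable_rV.
Context (R : realType).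

Lemma continuous_measurable_rV d (g : 'rV[R]_d -> R) :
  continuous g -> measurable_fun setT g.
Proof.
move=> /continuousP cg; apply: (measurability _ (RGenOpens.measurableE R)).
move=> _ [_ [a [b ->]] <-]; rewrite setTI.
by apply: sub_sigma_algebra; apply: cg; exact: interval_open.
Qed.

Lemma measurable_coord d (i : 'I_d) :
  measurable_fun setT (fun x : 'rV[R]_d => x ord0 i).
Proof. by apply: continuous_measurable_rV => x; exact: coord_continuous. Qed.

(** The Borel sigma-algebra on row vectors is generated by open sets, not by coordinates; factoring
    through tuples reduces the claim to [measurable_row_of_tuple]. *)
Lemma measurable_rV_coordP d dT (T : measurableType dT) (g : T -> 'rV[R]_d) :
  (forall i, measurable_fun setT (fun t => g t ord0 i)) -> measurable_fun setT g.
Proof.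
move=> mg; pose h t := [tuple g t ord0 i | i < d].
have -> : g = row_of_tuple (R := R) (n := d) \o h.
  by apply/funext => t; apply/rowP => i /=; rewrite mxE tnth_mktuple.
apply: measurableT_comp; first exact: measurable_row_of_tuple.
apply/measurable_fun_tnthP => i; rewrite (_ : _ \o _ = fun t => g t ord0 i)//.
by apply/funext => t; rewrite /h /= tnth_mktuple.
Qed.

End measurable_rV.

Section norm_measure.
Context (R : realType) (d : nat) (N : 'rV[R]_d -> R) (normN : is_norm N).

Lemma measurable_is_norm : measurable_fun setT N.
Proof. by apply: continuous_measurable_rV; exact: is_norm_continuous. Qed.

Lemma measurable_rVB dT (T : measurableType dT) (g h : T -> 'rV[R]_d) :
  measurable_fun setT g -> measurable_fun setT h ->
  measurable_fun setT (fun t => g t - h t).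
Proof.
move=> mg mh; apply: measurable_rV_coordP => i.
rewrite (_ : (fun t => _) = (fun t => g t ord0 i - h t ord0 i)); last first.
  by apply/funext => t; rewrite !mxE.
by apply: measurable_funB;
  apply: (measurableT_comp (measurable_coord (R := R) i)).
Qed.

Lemma measurable_is_normB dT (T : measurableType dT) (g h : T -> 'rV[R]_d) :
  measurable_fun setT g -> measurable_fun setT h ->
  measurable_fun setT (fun t => N (g t - h t)).
Proof.
by move=> mg mh; apply: (measurableT_comp measurable_is_norm); exact: measurable_rVB.
Qed.

Lemma measurable_cball x r : measurable (cball N x r).
Proof.
rewrite (_ : cball N x r = (fun y => N (x - y)) @^-1` `]-oo, r]); last first.
  by apply/seteqP; split => y; rewrite /cball /= in_itv.
rewrite -[X in measurable X]setTI.
by apply: measurable_is_normB => //; exact: measurable_id.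
Qed.

Let lebesgue_cube (c : R) : 0 <= c ->
  lebesgue_rV R d [set v | forall i, `[- c, c]%classic (v ord0 i)] = ((2 * c) ^+ d)%:E.
Proof.
move=> c0; rewrite (@lebesgue_rV_box R d (fun=> `[- c, c]%classic))//.
rewrite (eq_bigr (fun=> (2 * c)%:E)); last first.
  move=> i _; rewrite lebesgue_measure_itv/= lte_fin.
  case: ltP => [_|cc]; first by rewrite -EFinD; congr EFin; ring.
  by congr EFin; lra.
elim: d => [|n IHn]; first by rewrite big_ord0 expr0.
by rewrite big_ord_recr/= IHn -EFinM exprSr.
Qed.

Let measurable_cube (c : R) :
  measurable [set v : 'rV[R]_d | forall i, `[- c, c]%classic (v ord0 i)].
Proof.
rewrite (_ : [set _ | _] = \bigcap_(i in [set: 'I_d])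
    ((fun v : 'rV[R]_d => v ord0 i) @^-1` `[- c, c]%classic)).
  apply: fin_bigcap_measurable => // i _.
  by rewrite -[X in measurable X]setTI; exact: measurable_coord.
by apply/seteqP; split => t /= tB i; [move=> _|]; exact: tB.
Qed.

(** As [fine] sends infinity to 0, finiteness is needed as well as positivity. The ball lies between
    the cubes of half-sides [K^-1] and [c^-1] given by the comparison with the sup norm. *)
Lemma unit_ball_volume_gt0 : 0 < unit_ball_volume N.
Proof.
have [K K0 NK] := is_norm_upper normN; have [c c0 cN] := is_norm_lower normN.
apply: fine_gt0; apply/andP; split.
  apply: (@lt_le_trans _ _ ((2 * K^-1) ^+ d)%:E).
    by rewrite lte_fin exprn_gt0// mulr_gt0// invr_gt0.
  rewrite -lebesgue_cube; last by rewrite invr_ge0 ltW.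
  apply: le_measure; rewrite ?inE; [exact: measurable_cube|exact: measurable_cball|].
  move=> v /= vK; rewrite /cball/= sub0r (is_normN normN) (le_trans (NK _))//.
  rewrite mulrC -ler_pdivlMr// mul1r.
  rewrite [leLHS]/Num.Def.normr /= mx_normrE; apply/bigmax_leP; split => /=.
    by rewrite invr_ge0 ltW.
  move=> -[i j] _ /=; rewrite ord1; have := vK j.
  by rewrite /= in_itv/= ler_norml.
apply: (@le_lt_trans _ _ ((2 * c^-1) ^+ d)%:E); last by rewrite ltry.
rewrite -lebesgue_cube; last by rewrite invr_ge0 ltW.
apply: le_measure; rewrite ?inE; [exact: measurable_cball|exact: measurable_cube|].
move=> v; rewrite /cball/= sub0r (is_normN normN) => Nv i; rewrite in_itv/= -ler_norml.
rewrite -[c^-1]mul1r ler_pdivlMr//.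
rewrite mulrC (le_trans _ Nv)// (le_trans _ (cN _))// ler_pM2l//.
exact: coord_le_norm.
Qed.

Lemma rat_rV_dense (x : 'rV[R]_d) (r : R) : 0 < r ->
  exists q : 'rV[rat]_d, N (x - \row_i ratr (q ord0 i)) <= r.
Proof.
move=> r0; have [K K0 NK] := is_norm_upper normN.
have rK : 0 < r / K by rewrite divr_gt0.
have qP i : exists q : rat, `|x ord0 i - ratr q| < r / K.
  have /rat_in_itvoo[q qx] : x ord0 i - r / K < x ord0 i + r / K by lra.
  by exists q; move: qx; rewrite in_itv/= => /andP[q1 q2]; rewrite ltr_norml; lra.
exists (\row_i sval (cid (qP i))); rewrite (le_trans (NK _))// mulrC -ler_pdivlMr//.
rewrite [leLHS]/Num.Def.normr /= mx_normrE; apply/bigmax_leP; split => /=.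
  exact: ltW.
by move=> -[i j] _ /=; rewrite (ord1 i) !mxE ltW//; exact: svalP (cid (qP j)).
Qed.

(** The complement of the support is covered by the null balls with rational centre and radius of
    the form 1/(k+1), of which there are countably many. *)
Lemma supp_ae (mu : {measure set 'rV[R]_d -> \bar R}) :
  {ae mu, forall x, supp N mu x}.
Proof.
pose B (z : 'rV[rat]_d * nat) := cball N (\row_i ratr (z.1 ord0 i)) z.2.+1%:R^-1.
pose F n := if unpickle n is Some z then
  (if mu (B z) == 0%E then B z else set0) else set0.
have : mu.-negligible (\bigcup_n F n).
  apply: negligible_bigcup => n; rewrite /F; case: unpickle => [z|]; last exact: negligible_set0.
  case: eqP => [Bz|_]; last exact: negligible_set0.
  by exists (B z); split => //; exact: measurable_cball.
apply: negligibleS => x /= /existsNP[r /not_implyP[r0 /negP]].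
rewrite -leNgt => xr.
(* A radius below [r / 2] makes the rational ball contain [x] and stay inside the null ball of
   radius [r] around [x]. *)
have /ltr_add_invr[k] : 0 < r / 2 by rewrite divr_gt0.
rewrite add0r => kr.
have k0 : 0 < k.+1%:R^-1 :> R by rewrite invr_gt0.
have [q xq] := rat_rV_dense x k0.
exists (pickle (q, k)) => //; rewrite /F pickleK ifT.
  by rewrite /B/= /cball/= (is_normB normN).
rewrite eq_le measure_ge0 andbT (le_trans _ xr)//.
apply: le_measure; rewrite ?inE; [exact: measurable_cball|exact: measurable_cball|].
move=> y; rewrite /B /cball/= => qy.
rewrite (le_trans (is_normB_triangle normN (\row_i ratr (q ord0 i)) _ _))//.
by rewrite (le_trans (lerD xq qy))// [leRHS]splitr lerD// ltW.
Qed.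

End norm_measure.

(** * Nearest neighbours *)

Section nearest_neighbour_selection.
Context (R : realType) (d : nat) (N : 'rV[R]_d -> R).

(** For [j < m] and [k <= m] this is the indicator that [j] is one of the [k] nearest neighbours of
    [x]; the sum over ranks is the one occurring in [nn_weight]. *)
Definition nn_select (x' : nat -> 'rV[R]_d) (m k : nat) (x : 'rV[R]_d)
  (j : nat) : R := \sum_(l < k) (j == nn_index N x' m x l)%:R.

Section fixed_points.
Context (x' : nat -> 'rV[R]_d) (x : 'rV[R]_d) (m : nat).

Lemma nn_order_total : total (nn_order N x' x).
Proof.
by move=> i j; rewrite /nn_order; case: ltgtP => //= _; exact: leq_total.
Qed.

Lemma nn_order_trans : transitive (nn_order N x' x).
Proof.
move=> j i l; rewrite /nn_order => /orP[ij|/andP[/eqP -> ij]] /orP[jl|/andP[/eqP <- jl]].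
- by rewrite (lt_trans ij jl).
- by rewrite ij.
- by rewrite jl.
- by rewrite eqxx (leq_trans ij jl) orbT.
Qed.

Lemma nn_order_refl : reflexive (nn_order N x' x).
Proof. by move=> i; rewrite /nn_order eqxx leqnn orbT. Qed.

Let s := sort (nn_order N x' x) (iota 0 m).

Let size_s : size s = m. Proof. by rewrite size_sort size_iota. Qed.

Let uniq_s : uniq s. Proof. by rewrite sort_uniq iota_uniq. Qed.

Let mem_s j : (j \in s) = (j < m)%N. Proof. by rewrite mem_sort mem_iota. Qed.

Lemma nn_index_lt l : (l < m)%N -> (nn_index N x' m x l < m)%N.
Proof. by move=> lm; rewrite -mem_s /nn_index mem_nth// size_s. Qed.

(** The sorted list enumerates the indices below [m] without repetition, so [j] occurs at exactly
    one rank, and at most one term of the sum is nonzero. *)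
Lemma nn_selectE k j : (k <= m)%N -> (j < m)%N ->
  nn_select x' m k x j = (index j s < k)%N%:R.
Proof.
move=> km jm; have js : (index j s < m)%N by rewrite -[ltnRHS]size_s index_mem mem_s.
rewrite /nn_select (eq_bigr (fun l : 'I_k => (index j s == l)%:R)); last first.
  move=> l _; congr (_%:R); rewrite /nn_index -/s.
  rewrite -{1}(nth_index 0%N (_ : j \in s)) ?mem_s//.
  by rewrite nth_uniq// size_s// (leq_trans (ltn_ord l)).
case: ltnP => [jk|kj].
  rewrite (bigD1 (Ordinal jk))//= eqxx big1 ?addr0// => i.
  by rewrite -val_eqE/= eq_sym => /negbTE ->.
by rewrite big1// => i _; rewrite gtn_eqF// (leq_trans (ltn_ord i)).
Qed.

Lemma nn_select_sum k (F : nat -> R) : (k <= m)%N ->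
  \sum_(j < m) nn_select x' m k x j * F j = \sum_(l < k) F (nn_index N x' m x l).
Proof.
move=> km; under eq_bigr do rewrite mulr_suml.
rewrite exchange_big /=; apply: eq_bigr => l _.
have lm := nn_index_lt (leq_trans (ltn_ord l) km).
rewrite (bigD1 (Ordinal lm))//= eqxx mul1r big1 ?addr0// => i.
by rewrite -val_eqE/= => /negbTE ->; rewrite mul0r.
Qed.

Lemma nn_select_total k : (k <= m)%N -> \sum_(j < m) nn_select x' m k x j = k%:R.
Proof.
move=> km; transitivity (\sum_(j < m) nn_select x' m k x j * 1).
  by apply: eq_bigr => j _; rewrite mulr1.
by rewrite (nn_select_sum (fun=> 1))// sumr_const card_ord.
Qed.

Lemma nn_select_ge0 k j : 0 <= nn_select x' m k x j.
Proof. exact: sumr_ge0. Qed.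

Lemma nn_select_le1 k j : (k <= m)%N -> (j < m)%N -> nn_select x' m k x j <= 1.
Proof. by move=> km jm; rewrite nn_selectE//; case: ltnP. Qed.

(* With [t] the value at the k-th neighbour, [F j - t] is nonpositive exactly
   on the selected indices, so no other choice of [k] indices has a smaller sum. *)
Lemma nn_select_min k (F : nat -> R) (e : 'I_k -> 'I_m) :
  (k <= m)%N -> injective e ->
  (forall i j, N (x - x' i) <= N (x - x' j) -> F i <= F j) ->
  \sum_(j < m) nn_select x' m k x j * F j <= \sum_(g < k) F (e g).
Proof.
move=> km inje homF; have [k0|k_gt0] := posnP k.
  subst k; rewrite big_ord0 big1// => j _.
  by rewrite /nn_select big_ord0 mul0r.
pose t := F (nn_index N x' m x k.-1).
have kk : (k.-1 < k)%N by rewrite prednK.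
(* Both selections have total mass [k], so subtracting [t] from [F] shifts both sums by the same
   [t *+ k], and the comparison can be made index by index. *)
have -> : \sum_(g < k) F (e g) =
    \sum_(j < m) (\sum_(g < k) (j == e g)%:R) * (F j - t) + t *+ k.
  under [in RHS]eq_bigr do rewrite mulr_suml.
  rewrite exchange_big /= -[in t *+ k](card_ord k) -sumr_const -big_split/=.
  apply: eq_bigr => g _.
  rewrite (bigD1 (e g))//= eqxx mul1r big1 ?addr0 ?subrK// => i.
  by move=> /negbTE ->; rewrite mul0r.
have -> : \sum_(j < m) nn_select x' m k x j * F j =
    \sum_(j < m) nn_select x' m k x j * (F j - t) + t *+ k.
  rewrite (nn_select_sum (fun j => F j - t))// nn_select_sum//.
  by rewrite sumrB sumr_const card_ord subrK.
rewrite lerD2r; apply: ler_sum => j _.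
have js : (index (j : nat) s < m)%N by rewrite -[ltnRHS]size_s index_mem mem_s.
have ord_s a b : (a <= b)%N -> (b < m)%N -> F (nth 0%N s a) <= F (nth 0%N s b).
  move=> ab bm; apply: homF.
  have := @sorted_leq_nth _ _ nn_order_trans nn_order_refl 0%N s
    (sort_sorted nn_order_total _) a b.
  rewrite !inE size_s (leq_ltn_trans ab bm) bm => /(_ isT isT ab).
  by rewrite /nn_order => /orP[/ltW//|/andP[/eqP -> _]].
have jE : F j = F (nth 0%N s (index (j : nat) s)) by rewrite nth_index// mem_s.
have tE : t = F (nth 0%N s k.-1) by [].
(* Injectivity of [e] limits the multiplicity of each index to 1. *)
have cnt1 : \sum_(g < k) (j == e g)%:R <= 1 :> R.
  have [[g jg]|nj] := pselect (exists g, j = e g).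
    rewrite (bigD1 g)//= jg eqxx big1 ?addr0// => i ig.
    by rewrite (inj_eq inje) eq_sym (negbTE ig).
  by rewrite big1// => g _; case: eqP => // jg; case: nj; exists g.
rewrite nn_selectE//; case: ltnP => jk.
  rewrite mul1r -subr_ge0 -{2}[F j - t]mul1r -mulrBl.
  have jk1 : (index (j : nat) s <= k.-1)%N by rewrite -ltnS prednK.
  have km1 : (k.-1 < m)%N := leq_trans kk km.
  by rewrite mulr_le0// subr_le0// jE tE ord_s.
rewrite mul0r mulr_ge0// ?sumr_ge0// subr_ge0 jE tE ord_s//.
by rewrite (leq_trans _ jk)// leq_pred.
Qed.

End fixed_points.

Lemma nn_estimatorE (x x' : nat -> 'rV[R]_d) (z : nat -> R) (m n k : nat) :
  (0 < m)%N ->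
  nn_estimator N x x' z m n k =
  \sum_(j < m) ((k * n)%:R^-1 * \sum_(i < n) nn_select x' m k (x i) j) * z j.
Proof.
move=> m0; rewrite /nn_estimator mulr_sumr; apply: eq_bigr => j _.
rewrite /nn_weight !mulrA mulVf ?mul1r// pnatr_eq0; exact/lt0n_neq0.
Qed.

Section measurability.
Context dT (T : measurableType dT) (normN : is_norm N).
Context (x : T -> 'rV[R]_d) (x' : nat -> T -> 'rV[R]_d).
Hypotheses (mx : measurable_fun setT x) (mx' : forall j, measurable_fun setT (x' j)).

Lemma measurable_nn_order i j :
  measurable_fun setT (fun t => nn_order N (x' ^~ t) (x t) i j).
Proof.
have mN l : measurable_fun setT (fun t => N (x t - x' l t)).
  by apply: measurable_is_normB.
apply: measurable_or; first exact: measurable_fun_ltr.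
by apply: measurable_and => //; exact: measurable_fun_eqr.
Qed.

(* The sorted sequence only depends on the finite table of comparisons. *)
Lemma measurable_nn_index m l j :
  measurable [set t | nn_index N (x' ^~ t) m (x t) l = j].
Proof.
pose tbl t : {ffun 'I_m * 'I_m -> bool} :=
  [ffun ij : 'I_m * 'I_m => nn_order N (x' ^~ t) (x t) ij.1 ij.2].
pose idx (b : {ffun 'I_m * 'I_m -> bool}) :=
  nth 0%N (map val (sort (fun i j : 'I_m => b (i, j)) (enum 'I_m))) l.
have idxE t : nn_index N (x' ^~ t) m (x t) l = idx (tbl t).
  rewrite /nn_index /idx -val_enum_ord sort_map; congr (nth _ (map _ (sort _ _)) _).
  by apply/funext => a; apply/funext => b; rewrite ffunE.
rewrite (_ : [set t | _] =
    \bigcup_(b in [set b | idx b = j]) (tbl @^-1` [set b])); last first.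
  apply/seteqP; split => t /=; rewrite idxE; first by exists (tbl t).
  by move=> [b /= <- ->].
apply: fin_bigcup_measurable => // b _.
pose cmp (ij : 'I_m * 'I_m) :=
  [set t | nn_order N (x' ^~ t) (x t) ij.1 ij.2 = b ij].
rewrite (_ : _ @^-1` _ = \bigcap_(ij in [set: 'I_m * 'I_m]) cmp ij).
  apply: fin_bigcap_measurable => // ij _.
  have := measurable_nn_order ij.1 ij.2 measurableT.
  by move=> /(_ [set b ij]); rewrite setTI; exact.
apply/seteqP; split => t /=; first by move=> tb ij _; rewrite /cmp/= -tb ffunE.
by move=> h; apply/ffunP => ij; rewrite ffunE; exact: h.
Qed.

Lemma measurable_nn_select m k j :
  measurable_fun setT (fun t => nn_select (x' ^~ t) m k (x t) j).
Proof.
apply: measurable_sum => l.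
rewrite (_ : (fun t => _) = \1_[set t | nn_index N (x' ^~ t) m (x t) l = j]).
  exact/measurable_indicP/measurable_nn_index.
apply/funext => t; rewrite indicE; congr (nat_of_bool _)%:R.
by apply/eqP/idP => [->|]; rewrite inE.
Qed.

End measurability.

End nearest_neighbour_selection.

(** * Tail bounds, orthogonality and freezing *)

Section expectation_bounds.
Local Open Scope ereal_scope.
Context dT (T : measurableType dT) (R : realType) (P : probability T R).

Lemma bounded_integrable (f : T -> R) (K : R) : measurable_fun setT f ->
  (forall t, `|f t| <= K)%R -> P.-integrable setT (EFin \o f).
Proof.
move=> mf fK; apply: measurable_bounded_integrable => //.
  by rewrite ltey_eq fin_num_measure.
exists K; split; first exact: num_real.
move=> M KM t _ /=.
by rewrite (le_trans (fK t))// ltW.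
Qed.

(** The partial sums up to index [m] stay below [3 - 2 / (m + 1)], a bound that passes through
    induction. The term at 0 is set to 1 to match the trivial bound on a probability. *)
Lemma inverse_square_sum (n : nat) :
  (\sum_(i < n) (if i == 0%N :> nat then 1 else (i%:R ^+ 2)^-1) <= 3 :> R)%R.
Proof.
have h m : (\sum_(i < m.+1) (if i == 0%N :> nat then 1 else (i%:R ^+ 2)^-1) <=
    3 - 2 / m.+1%:R :> R)%R.
  elim: m => [|m IHm]; first by rewrite big_ord_recl big_ord0/=; lra.
  rewrite big_ord_recr/= (le_trans (lerD IHm (lexx _)))//.
  rewrite -subr_ge0.
  have m0 : (0 <= m%:R :> R)%R by [].
  rewrite -(natr1 m.+1) -natr1; set x : R := m%:R.
  rewrite [X in (0 <= X)%R](_ : _ = x / ((x + 1) ^+ 2 * (x + 1 + 1)))%R; last first.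
    by field; rewrite /x; apply/andP; split; apply/eqP; lra.
  by rewrite divr_ge0// mulr_ge0// ?sqr_ge0//; lra.
case: n => [|n]; first by rewrite big_ord0.
by rewrite (le_trans (h n))// lerBlDr lerDl.
Qed.

(** Discretization at step [a]: [Z] is at most the sum over [i] of [a] times the indicator of
    [Z > a * i]. These events have probability at most 1 for [i = 0] and [i ^ -2] afterwards. *)
Lemma ge0_expectation_tail (Z : T -> R) (a : R) : measurable_fun setT Z ->
  (forall t, 0 <= Z t)%R -> (0 < a)%R ->
  (forall s, (0 < s)%R -> P [set t | (s < Z t)%R] <= ((a / s) ^+ 2)%:E) ->
  \int[P]_t (Z t)%:E <= (3 * a)%:E.
Proof.
move=> mZ Z0 a0 tailZ.
pose E i := [set t | (a * i%:R < Z t)%R].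
have mE i : measurable (E i).
  rewrite (_ : E i = Z @^-1` `](a * i%:R)%R, +oo[%classic).
    by rewrite -[X in measurable X]setTI; exact: mZ.
  by apply/seteqP; split => t; rewrite /E/= in_itv/= andbT.
pose u i t := (a * \1_(E i) t)%:E.
have u0 i t : 0 <= u i t by rewrite lee_fin mulr_ge0// ltW.
have mu i : measurable_fun setT (u i).
  by apply/measurable_EFinP; apply: measurable_funM => //; exact/measurable_indicP.
have ui i : \int[P]_t u i t = a%:E * P (E i).
  rewrite /u; under eq_integral do rewrite EFinM.
  rewrite ge0_integralZl_EFin//; first by rewrite integral_indic// setIT.
  - by apply/measurable_EFinP; exact/measurable_indicP.
  - exact: ltW.
apply: (@le_trans _ _ (\int[P]_t \sum_(i <oo) u i t)).
  apply: ge0_le_integral => //.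
  - by move=> t _; rewrite lee_fin.
  - exact/measurable_EFinP.
  - exact: ge0_emeasurable_sum.
  move=> t _.
  (* Truncating [Z] at [a * n] makes the pointwise bound provable by induction; for large [n] the
     truncation is inactive. *)
  have h n : (Num.min (Z t) (a * n%:R) <= \sum_(i < n) a * \1_(E i) t)%R.
    elim: n => [|n IHn]; first by rewrite big_ord0 mulr0 ge_min lexx orbT.
    rewrite big_ord_recr/=; have [En|En] := ltP (a * n%:R)%R (Z t).
      rewrite indicE mem_set// mulr1 ge_min; apply/orP; right.
      rewrite -natr1 mulrDr mulr1 lerD2r (le_trans _ IHn)// le_min lexx andbT.
      exact: ltW.
    rewrite ge_min; apply/orP; left.
    rewrite (@le_trans _ _ (\sum_(i < n) a * \1_(E i) t)%R)//.
      by rewrite (le_trans _ IHn)// le_min lexx.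
    by rewrite lerDl mulr_ge0// ltW.
  pose n := (Num.truncn (Z t / a)).+1.
  have Zn : (Z t <= a * n%:R)%R.
    by rewrite mulrC -ler_pdivrMr//; apply/ltW/truncnS_gt.
  apply: (@le_trans _ _ (\sum_(0 <= i < n) u i t)); last first.
    exact: nneseries_lim_ge.
  rewrite big_mkord sumEFin lee_fin (le_trans _ (h n))//.
  by rewrite le_min lexx.
rewrite integral_nneseries//.
apply: lime_le; first by apply: is_cvg_nneseries => n _ _; exact: integral_ge0.
apply: nearW => n; rewrite big_mkord.
apply: (@le_trans _ _
    (\sum_(i < n) (a * (if i == 0%N :> nat then 1 else (i%:R ^+ 2)^-1))%:E)).
  apply: lee_sum => i _; rewrite ui EFinM; apply: lee_wpmul2l.
    by rewrite lee_fin ltW.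
  case: eqP => [_|/eqP i0]; first exact: probability_le1.
  have i_gt0 : (0 < (i : nat)%:R :> R)%R by rewrite ltr0n lt0n.
  rewrite (le_trans (tailZ _ _)) ?mulr_gt0// lee_fin.
  by rewrite invfM mulrA divff ?gt_eqF// mul1r exprVn.
by rewrite sumEFin lee_fin -mulr_sumr mulrC ler_wpM2r ?inverse_square_sum// ltW.
Qed.

Lemma integral_sqr_sum_orthogonal (n : nat) (Z : 'I_n -> T -> R) (K : R) :
  (forall i, measurable_fun setT (Z i)) -> (forall i t, `|Z i t| <= K)%R ->
  (forall i j, i != j -> \int[P]_t (Z i t * Z j t)%:E = 0) ->
  \int[P]_t ((\sum_i Z i t) ^+ 2)%:E = \sum_i \int[P]_t (Z i t ^+ 2)%:E.
Proof.
move=> mZ ZK oZ.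
have iZ i j : P.-integrable setT (fun t => (Z i t * Z j t)%:E).
  apply: (@bounded_integrable _ (K * K)%R); first exact: measurable_funM.
  by move=> t; rewrite normrM ler_pM.
transitivity (\int[P]_t \sum_i \sum_j (Z i t * Z j t)%:E).
  apply: eq_integral => t _; rewrite expr2 big_distrlr/=.
  by rewrite -sumEFin; apply: eq_bigr => i _; rewrite sumEFin.
rewrite integral_sum//; last by move=> i; exact: integrable_sum.
apply: eq_bigr => i _; rewrite integral_sum// (bigD1 i)//= big1 ?adde0//.
by move=> j ji; rewrite oZ// eq_sym.
Qed.

End expectation_bounds.

(* A function that is measurable on [g_sigma_algebraType G] depends only on the
   randomness in [G]: freezing it while integrating over [Y] needs no joint law
   of the (possibly infinitely many) variables that generate [G]. *)
Section freezing.
Local Open Scope ereal_scope.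
Context dT (T : measurableType dT) (R : realType) (P : probability T R).
Context dY (TY : measurableType dY) (Y : T -> TY) (mu : probability TY R).
Hypothesis mY : measurable_fun setT Y.
Context (G : set_system T).
Hypotheses (GI : setI_closed G) (Gm : G `<=` measurable) (GT : G setT).
Hypothesis indep : forall A B, G A -> measurable B ->
  P (A `&` Y @^-1` B) = P A * mu B.

(** For fixed [B] both sides are finite measures in [A] that agree on [G], which is closed under
    intersection and contains the whole space; hence they agree on the generated sigma-algebra. *)
Lemma independent_g_sigma_algebra A B : <<s G >> A -> measurable B ->
  P (A `&` Y @^-1` B) = P A * mu B.
Proof.
move=> sA mB.
have mYB : measurable (Y @^-1` B) by rewrite -[X in measurable X]setTI; exact: mY.
have muB : (0 <= fine (mu B))%R by rewrite fine_ge0.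
have mscaleE C : mscale (NngNum muB) P C = P C * mu B.
  rewrite /mscale muleC; congr (_ * _).
  by rewrite -[RHS]fineK// fin_num_measure.
rewrite -mscaleE; apply: (g_sigma_algebra_measure_unique G Gm (fun=> setT) _ _
     (mrestr P mYB) (mscale (NngNum muB) P)) => //.
- by rewrite bigcup_const.
- move=> C GC; transitivity (P (C `&` Y @^-1` B)) => //.
    by rewrite indep//; exact/esym/mscaleE.
by move=> k; rewrite ltey_eq fin_num_measure.
Qed.

Let S := g_sigma_algebraType G.

Let mid : measurable_fun setT (id : T -> S).
Proof.
move=> _ A sA; rewrite setTI preimage_id.
exact: (smallest_sub (@sigma_algebra_measurable _ T) Gm).
Qed.

Let idm : {mfun T >-> S} := HB.pack (id : T -> S) (isMeasurableFun.Build _ _ _ _ _ mid).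

Let mgraph : measurable_fun setT ((fun t => (t, Y t)) : T -> (S * TY)%type).
Proof. by apply/measurable_fun_pairP; split => //; exact: mid. Qed.

Let graph : {mfun T >-> (S * TY)%type} :=
  HB.pack ((fun t => (t, Y t)) : T -> (S * TY)%type)
    (isMeasurableFun.Build _ _ _ _ _ mgraph).

(** The first coordinate is the whole outcome, seen only through the sigma-algebra generated by [G].
    Independence on rectangles makes the joint law a product, so that Tonelli applies. *)
Let graph_law (A : set (S * TY)) : measurable A ->
  (distribution P idm \x mu) A = distribution P graph A.
Proof.
apply: product_measure_unique => A' B mA' mB.
by rewrite /= /distribution /pushforward/= -independent_g_sigma_algebra.
Qed.

Lemma ge0_integral_freeze (h : S * TY -> \bar R) : measurable_fun setT h ->
  (forall z, 0 <= h z) ->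
  \int[P]_t h (t, Y t) = \int[P]_t \int[mu]_y h (t, y).
Proof.
move=> mh h0; transitivity (\int[distribution P graph]_z h z).
  by rewrite ge0_integral_distribution.
transitivity (\int[distribution P idm \x mu]_z h z).
  by apply: eq_measure_integral => A mA _; exact/esym/graph_law.
rewrite fubini_tonelli1// ge0_integral_distribution//.
  exact: measurable_fun_fubini_tonelli_F.
by move=> t; exact: integral_ge0.
Qed.

Lemma ge0_integral_freeze_swap (h : S * TY -> \bar R) : measurable_fun setT h ->
  (forall z, 0 <= h z) ->
  \int[P]_t h (t, Y t) = \int[mu]_y \int[P]_t h (t, y).
Proof.
move=> mh h0; transitivity (\int[distribution P graph]_z h z).
  by rewrite ge0_integral_distribution.
transitivity (\int[distribution P idm \x mu]_z h z).
  by apply: eq_measure_integral => A mA _; exact/esym/graph_law.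
rewrite fubini_tonelli2//; apply: eq_integral => y _.
rewrite /fubini_G ge0_integral_distribution//.
exact: measurableT_comp.
Qed.

(** Adding [K] makes the integrand nonnegative, which brings it under the Tonelli form of freezing;
    the constant is removed afterwards. *)
Lemma bounded_integral_freeze0 (h : S * TY -> R) (K : R) :
  measurable_fun setT h -> (forall z, `|h z| <= K)%R ->
  (forall t, \int[mu]_y (h (t, y))%:E = 0) ->
  \int[P]_t (h (t, Y t))%:E = 0.
Proof.
move=> mh hK h0.
have mhY : measurable_fun setT (fun t => h (t, Y t)).
  exact: (measurableT_comp mh mgraph).
have mht t : measurable_fun setT (fun y => h (t, y)).
  exact: measurableT_comp.
have : \int[P]_t (h (t, Y t) + K)%:E = K%:E.
  rewrite (@ge0_integral_freeze (fun z => (h z + K)%:E)); last 2 first.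
  - by apply/measurable_EFinP; exact: measurable_funD.
  - by move=> z; rewrite lee_fin; have := hK z; rewrite ler_norml; lra.
  transitivity (\int[P]_t (cst K%:E t)); last first.
    by rewrite integral_cst//= probability_setT mule1.
  apply: eq_integral => t _; under eq_integral do rewrite EFinD.
  rewrite integralD//.
  - by rewrite h0 add0e integral_cst//= probability_setT mule1.
  - exact: (@bounded_integrable _ _ _ _ _ K).
  - exact: finite_measure_integrable_cst.
under eq_integral do rewrite EFinD.
rewrite integralD//.
- rewrite integral_cst//= probability_setT mule1.
  by case: (\int[P]_t _) => [r [rK]|//|//]; congr EFin; lra.
- exact: (@bounded_integrable _ _ _ _ _ K).
- exact: finite_measure_integrable_cst.
Qed.

End freezing.

(** * Distance to the nearest sample point *)

Section tail_power_bound.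
Context (R : realType) (d : nat) (d_gt0 : (0 < d)%N).

Let alpha : R := 2 / d%:R.

(** Since [0 <= alpha <= 2], [t ^ alpha <= 1 + t ^ 2 <= 16 * (1 + t / 4) ^ 2], while
    [exp t >= (1 + t / 4) ^ 4]. *)
Lemma expRN_powR_bound (t : R) : 0 < t -> expR (- t) * (t `^ alpha) ^+ 2 <= 16 ^+ 2.
Proof.
move=> t0; have d1 : 1 <= d%:R :> R by rewrite ler1n.
have a0 : 0 <= alpha by rewrite /alpha divr_ge0.
have a2 : alpha <= 2 by rewrite /alpha ler_pdivrMr ?ltr0n//; lra.
have t_alpha : t `^ alpha <= 1 + t ^+ 2.
  have [t1|t1] := leP t 1.
    rewrite (@le_trans _ _ (1 `^ alpha))//; last by rewrite powR1 lerDl sqr_ge0.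
    by apply: ge0_ler_powR; rewrite ?nnegrE// ltW.
  rewrite (@le_trans _ _ (t `^ 2%:R))//; first by apply: ler_powR => //; exact: ltW.
  by rewrite powR_mulrn ?lerDr//; lra.
have exp_t : ((1 + t / 4) ^+ 2) ^+ 2 <= expR t.
  have -> : expR t = (expR (t / 4) ^+ 2) ^+ 2.
    by rewrite -exprM -expRM_natl; congr expR; field.
  have h : (1 + t / 4) ^+ 2 <= expR (t / 4) ^+ 2.
    apply: lerXn2r; rewrite ?nnegrE ?expR_ge0 ?expR_ge1Dx//.
    by rewrite addr_ge0// mulr_ge0// ltW.
  by apply: lerXn2r; rewrite // nnegrE sqr_ge0.
rewrite expRN mulrC ler_pdivrMr ?expR_gt0//.
rewrite (le_trans _ (ler_wpM2l _ exp_t)) ?sqr_ge0//.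
rewrite -exprMn; apply: lerXn2r; rewrite ?nnegrE ?powR_ge0//.
  by rewrite mulr_ge0// sqr_ge0.
by rewrite (le_trans t_alpha)//; nra.
Qed.

(* [g r] stands for the probability that one sample point is farther than [r];
   the exponent [4 / d] in [exp (- t) = O(t ^ (- 4 / d))] makes both ranges of
   [s] decay like [s ^ -2]. *)
Lemma tail_power_bound (c rk lam nx : R) (g : R -> R) (q q0 : nat) :
  0 < rk -> 0 < lam -> 0 <= nx -> (0 < q)%N -> (q0 * 2 <= q)%N ->
  (forall r, 0 <= g r <= 1) -> {homo g : r r' /~ r <= r'} ->
  (forall r, 0 <= r <= rk -> g r <= 1 - lam * r ^+ d) ->
  (forall r, 0 < r -> g r ^+ q0 <= ((4 * nx ^+ 2 + 4 * c ^+ 2) / r ^+ 2) ^+ 2) ->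
  forall s, 0 < s -> g (Num.sqrt s) ^+ q <=
    ((16 + 256 * (1 + c ^+ 2) / rk ^+ 2) / (q%:R * lam) `^ alpha *
     (1 + nx ^+ 2) / s) ^+ 2.
Proof.
move=> rk0 lam0 nx0 q_gt0 qq0 g01 g_mono g_ball g_far s s0.
set D := (_ `^ alpha).
have d0 : 0 < d%:R :> R by rewrite ltr0n.
have qr0 : 0 < q%:R :> R by rewrite ltr0n.
have D0 : 0 < D by rewrite powR_gt0// mulr_gt0.
have a0 : 0 <= alpha by rewrite /alpha divr_ge0.
have a2 : alpha <= 2 by rewrite /alpha ler_pdivrMr// ler_pMr// ler1n.
(* Here [g r <= 1 - lam * r ^ d <= exp (- lam * r ^ d)], so the n-th power is at most [exp (- t)]
   with [t = n * lam * r ^ d], and [t ^ alpha = (n * lam) ^ alpha * r ^ 2]. *)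
have near_bound (n : nat) (r : R) : (0 < n)%N -> 0 < r <= rk ->
    g r ^+ n * ((n%:R * lam) `^ alpha * r ^+ 2) ^+ 2 <= 16 ^+ 2.
  move=> n0 /andP[r0 rrk].
  have nr0 : 0 < n%:R :> R by rewrite ltr0n.
  have rd0 : 0 < r ^+ d by rewrite exprn_gt0.
  have t0 : 0 < n%:R * lam * r ^+ d by rewrite !mulr_gt0.
  apply: le_trans (expRN_powR_bound t0).
  have -> : (n%:R * lam * r ^+ d) `^ alpha = (n%:R * lam) `^ alpha * r ^+ 2.
    rewrite powRM ?(ltW rd0) ?mulr_ge0 ?ltW//; congr (_ * _).
    rewrite -powR_mulrn ?(ltW r0)// -powRrM /alpha mulrCA divff ?gt_eqF// mulr1.
    by rewrite powR_mulrn// ltW.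
  apply: ler_wpM2r; first exact: sqr_ge0.
  rewrite -mulrA -mulrN expRM_natl.
  have /andP[g0 _] := g01 r.
  apply: lerXn2r; rewrite ?nnegrE ?expR_ge0//.
  apply: (le_trans (g_ball r _)); first by rewrite ltW.
  exact: expR_ge1Dx.
(* The 256 of the far range is 16 from [near_bound], times 4 from the numerator in [g_far], times 4
   from replacing [n] by [q] in [Dn]. *)
set W := 256 * (1 + c ^+ 2) / rk ^+ 2.
have W0 : 0 <= W.
  by rewrite divr_ge0 ?sqr_ge0// mulr_ge0// addr_ge0// sqr_ge0.
have X0 : 0 < (D * s)^-1 by rewrite invr_gt0 mulr_gt0.
rewrite (_ : _ / s = (16 + W) * (1 + nx ^+ 2) * (D * s)^-1); last first.
  by field; rewrite !gt_eqF.
have r0 : 0 < Num.sqrt s by rewrite sqrtr_gt0.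
have rhs0 : 0 <= (16 + W) * (1 + nx ^+ 2) * (D * s)^-1.
  by rewrite mulr_ge0 ?(ltW X0)// mulr_ge0// addr_ge0// sqr_ge0.
have [r_le|r_gt] := leP (Num.sqrt s) rk.
  have := near_bound q (Num.sqrt s) q_gt0; rewrite r0 r_le => /(_ isT).
  rewrite -/D sqr_sqrtr ?(ltW s0)// => h.
  have Ds0 : 0 < D * s by rewrite mulr_gt0.
  rewrite -ler_pdivlMr ?exprn_gt0// -expr_div_n in h.
  apply: (le_trans h).
  apply: lerXn2r; rewrite ?nnegrE//.
    by rewrite divr_ge0// ltW.
  rewrite ler_pM2r//; have := sqr_ge0 nx; nra.
(* Beyond [rk], [q0] of the [q] factors are spent on the moment bound, which decays in [s]. The
   other [n >= q / 2] are bounded by their value at [rk], which supplies the decay in [q]. *)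
pose n := (q - q0)%N.
have n_gt0 : (0 < n)%N by rewrite /n; move: q_gt0 qq0; clear; lia.
have nr0 : 0 < n%:R :> R by rewrite ltr0n.
have qn : (q <= 2 * n)%N by rewrite /n; move: q_gt0 qq0; clear; lia.
have nlam0 : 0 < n%:R * lam by rewrite mulr_gt0.
have Dn : D <= 4 * (n%:R * lam) `^ alpha.
  rewrite (@le_trans _ _ ((2 * (n%:R * lam)) `^ alpha))//.
    apply: ge0_ler_powR; rewrite ?nnegrE//.
    - by rewrite mulr_ge0// ltW.
    - by rewrite mulr_ge0// ltW.
    - by rewrite mulrA ler_pM2r// -natrM ler_nat.
  rewrite powRM// ?(ltW nlam0)//; apply: ler_wpM2r; first exact: powR_ge0.
  rewrite (@le_trans _ _ (2 `^ 2%:R))//; first by apply: ler_powR => //; lra.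
  by rewrite powR_mulrn//; lra.
have := near_bound n rk n_gt0; rewrite rk0 lexx => /(_ isT).
set Dn' := (_ `^ alpha) in Dn * => hn.
have Dn0 : 0 < Dn' by rewrite powR_gt0// mulr_gt0.
have rk2 : 0 < rk ^+ 2 by rewrite exprn_gt0.
rewrite -ler_pdivlMr ?exprn_gt0 ?mulr_gt0// -expr_div_n in hn.
have hf := g_far _ r0; rewrite sqr_sqrtr ?(ltW s0)// in hf.
have -> : q = (n + q0)%N by rewrite /n; move: q_gt0 qq0; clear; lia.
rewrite exprD.
have /andP[g0 _] := g01 (Num.sqrt s).
have /andP[g0' _] := g01 rk.
have hn' : g (Num.sqrt s) ^+ n <= (16 / (Dn' * rk ^+ 2)) ^+ 2.
  apply: le_trans hn; apply: lerXn2r; rewrite ?nnegrE//.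
  by apply: g_mono; exact: ltW.
rewrite (le_trans (ler_pM _ _ hn' hf)) ?exprn_ge0//.
rewrite -exprMn; apply: lerXn2r; rewrite ?nnegrE//.
  apply: mulr_ge0; first by rewrite divr_ge0// ltW// mulr_gt0.
  by rewrite divr_ge0 ?(ltW s0)// addr_ge0// mulr_ge0// sqr_ge0.
have -> : 16 / (Dn' * rk ^+ 2) * ((4 * nx ^+ 2 + 4 * c ^+ 2) / s) =
    (64 * (nx ^+ 2 + c ^+ 2) / rk ^+ 2) * (Dn' * s)^-1.
  by field; rewrite !gt_eqF.
have X1 : (Dn' * s)^-1 <= 4 * (D * s)^-1.
  rewrite (_ : 4 * (D * s)^-1 = (4^-1 * D * s)^-1); last first.
    by field; rewrite !gt_eqF.
  by rewrite lef_pV2 ?posrE ?mulr_gt0 ?invr_gt0// ler_pM2r// ler_pdivrMl.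
rewrite (le_trans (ler_wpM2l _ X1))//.
  by rewrite divr_ge0 ?(ltW rk2)// mulr_ge0// addr_ge0// sqr_ge0.
rewrite mulrA ler_pM2r// (@le_trans _ _ (W * (1 + nx ^+ 2)))//; last first.
  by rewrite ler_wpM2r ?lerDr// addr_ge0// sqr_ge0.
rewrite /W -[leLHS]mulrA mulrAC [leRHS]mulrAC -[leLHS]mulrA.
rewrite [leLHS](_ : _ = 256 * (nx ^+ 2 + c ^+ 2) / rk ^+ 2); last by ring.
rewrite ler_pM2r ?invr_gt0//.
have := sqr_ge0 nx; have := sqr_ge0 c; nra.
Qed.

End tail_power_bound.

(** * Consequences of independence *)

Section independence_consequences.
Local Open Scope ereal_scope.
Context dT (T : measurableType dT) (R : realType) (P : probability T R).

Lemma mutually_independent2 (I : choiceType) (F : I -> set_system T) i j A B :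
  mutually_independent P F -> i != j -> F i A -> F j B ->
  P (A `&` B) = P A * P B.
Proof.
move=> indF ij FA FB.
have := indF [:: i; j] (fun l => if l == i then A else B).
rewrite bigcap_seq !big_cons !big_nil setIT mule1 eqxx eq_sym (negbTE ij).
by apply => [|l]; rewrite /= !inE ?ij// => /orP[] /eqP ->; rewrite ?eqxx// eq_sym (negbTE ij).
Qed.

Lemma mutually_independent3 (I : choiceType) (F : I -> set_system T) i j l A B C :
  mutually_independent P F -> i != j -> i != l -> j != l ->
  F i A -> F j B -> F l C ->
  P (A `&` B `&` C) = P A * P B * P C.
Proof.
move=> indF ij il jl FA FB FC.
have := indF [:: i; j; l] (fun h => if h == i then A else if h == j then B else C).
have ji : (j == i) = false by rewrite eq_sym (negbTE ij).
have li : (l == i) = false by rewrite eq_sym (negbTE il).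
have lj : (l == j) = false by rewrite eq_sym (negbTE jl).
rewrite bigcap_seq !big_cons !big_nil setIT mule1 !eqxx ji li lj setIA muleA.
apply => [|h]; rewrite /= !inE; first by rewrite negb_or ij il jl.
by move=> /or3P[] /eqP ->; rewrite ?eqxx// ?ji ?li ?lj.
Qed.

Context dY (TY : measurableType dY).

Lemma sigma_rv_preimage (X : {RV P >-> TY}) B : measurable B ->
  sigma_rv X (X @^-1` B).
Proof. by move=> mB; exists B => //; rewrite setTI. Qed.

Lemma sigma_rv_measurable (X : {RV P >-> TY}) : sigma_rv X `<=` measurable.
Proof. by move=> _ [B mB <-]; exact: measurable_funP. Qed.

Lemma sigma_rvI (X : {RV P >-> TY}) : setI_closed (sigma_rv X).
Proof.
move=> _ _ [B mB <-] [C mC <-]; exists (B `&` C); first exact: measurableI.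
by rewrite !setTI preimage_setI.
Qed.

Lemma sigma_rvT (X : {RV P >-> TY}) : sigma_rv X setT.
Proof. by exists setT => //; rewrite setTI. Qed.

Lemma sub_sigma_rv_seq (X : nat -> {RV P >-> TY}) i :
  sigma_rv (X i) `<=` sigma_rv_seq X.
Proof. by move=> A XA; apply: sub_sigma_algebra; exists i. Qed.

Lemma sigma_rv_seq_measurable (X : nat -> {RV P >-> TY}) :
  sigma_rv_seq X `<=` measurable.
Proof.
apply: smallest_sub; first exact: sigma_algebra_measurable.
by move=> A [i _]; exact: sigma_rv_measurable.
Qed.

Lemma sigma_rv_seqI (X : nat -> {RV P >-> TY}) : setI_closed (sigma_rv_seq X).
Proof.
move=> A B.
exact: (@measurableI _ (g_sigma_algebraType (\bigcup_i sigma_rv (X i)))).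
Qed.

Lemma sigma_rv_seqT (X : nat -> {RV P >-> TY}) : sigma_rv_seq X setT.
Proof.
exact: (@measurableT _ (g_sigma_algebraType (\bigcup_i sigma_rv (X i)))).
Qed.

Lemma measurable_rv_sub (G : set_system T) (X : {RV P >-> TY}) :
  sigma_rv X `<=` <<s G >> ->
  measurable_fun setT (X : g_sigma_algebraType G -> TY).
Proof.
by move=> XG _ A mA; rewrite setTI; apply: XG; exact: sigma_rv_preimage.
Qed.

Lemma integral_law (X : {RV P >-> TY}) (mu : {measure set TY -> \bar R})
    (h : TY -> \bar R) :
  has_law X mu -> measurable_fun setT h -> (forall y, 0 <= h y) ->
  \int[P]_t h (X t) = \int[mu]_y h y.
Proof.
move=> lX mh h0; rewrite -(ge0_integral_distribution X)//.
by apply: eq_measure_integral => A mA _; exact: lX.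
Qed.

Lemma iid_power (X : nat -> {RV P >-> TY}) (mu : probability TY R) (o n : nat) B :
  iid X mu -> measurable B ->
  P (\bigcap_(j in [set` iota o n]) (X j @^-1` B)) = (fine (mu B) ^+ n)%:E.
Proof.
move=> [lX indX] mB.
rewrite (indX _ (fun j => X j @^-1` B) (iota_uniq _ _)); last first.
  by move=> i _; exact: sigma_rv_preimage.
rewrite (eq_bigr (fun=> mu B)); last by move=> i _; exact: lX.
rewrite -(@fineK _ (mu B)) ?fin_num_measure//.
elim: n o => [|n IHn] o; first by rewrite big_nil expr0.
by rewrite /= big_cons IHn exprS EFinM.
Qed.

End independence_consequences.

Lemma measurable_bigmin dS (S : measurableType dS) (R : realType) (I : Type)
    (r : seq I) (F0 : S -> R) (F : I -> S -> R) :
  measurable_fun setT F0 -> (forall i, measurable_fun setT (F i)) ->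
  measurable_fun setT (fun s => \big[Num.min/F0 s]_(i <- r) F i s).
Proof.
move=> mF0 mF; elim: r => [|i r IHr].
  by rewrite (_ : (fun s => _) = F0)//; apply/funext => s; rewrite big_nil.
rewrite (_ : (fun s => _) = F i \min (fun s => \big[Num.min/F0 s]_(i <- r) F i s)).
  exact: measurable_minr.
by apply/funext => s; rewrite big_cons.
Qed.

(** * Squared distance from a fixed point to a block of the sample *)

Section nearest_neighbour_distance.
Context (R : realType) (d : nat) (d_gt0 : (0 < d)%N).
Context (N : 'rV[R]_d -> R) (normN : is_norm N).
Context dT (T : measurableType dT) (P : probability T R).
Context (X' : nat -> {RV P >-> 'rV[R]_d}) (mu : probability 'rV[R]_d R).
Hypothesis iidX' : iid X' mu.

(** The block consists of the indices from [o] to [o + q - 1]. For [q > 0] the default value of the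
    minimum is the term of index [o], so it does not alter the result. *)
Definition min_sqdist (x : 'rV[R]_d) (o q : nat) (w : T) : R :=
  \big[Num.min/N (x - X' o w) ^+ 2]_(j < q) N (x - X' (o + j)%N w) ^+ 2.

Lemma min_sqdist_ge0 x o q w : 0 <= min_sqdist x o q w.
Proof.
by apply: le_bigmin => [|j _]; rewrite exprn_ge0// is_norm_ge0.
Qed.

Lemma min_sqdist_attained x o q w : (0 < q)%N ->
  exists j : 'I_q, N (x - X' (o + j)%N w) ^+ 2 <= min_sqdist x o q w.
Proof.
move=> q0; apply: contrapT => h.
have {}h (j : 'I_q) : min_sqdist x o q w < N (x - X' (o + j)%N w) ^+ 2.
  by rewrite ltNge; apply/negP => jq; apply: h; exists j.
suff : min_sqdist x o q w < min_sqdist x o q w by rewrite ltxx.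
apply: lt_bigmin => [|j _]; last exact: h.
by have := h (Ordinal q0); rewrite addn0.
Qed.

(** The centre and the outcome are maps on an arbitrary space [S], to cover products and smaller
    sigma-algebras on the sample space, as freezing requires. *)
Lemma measurable_min_sqdist dS (S : measurableType dS) (x : S -> 'rV[R]_d)
    (w : S -> T) (o q : nat) :
  measurable_fun setT x -> (forall j, measurable_fun setT (fun s => X' j (w s))) ->
  measurable_fun setT (fun s => min_sqdist (x s) o q (w s)).
Proof.
move=> mx mw; have m j : measurable_fun setT (fun s => N (x s - X' j (w s)) ^+ 2).
  by apply: measurable_funX; exact: measurable_is_normB.
exact: measurable_bigmin.
Qed.

Let far x r := fine (mu (~` cball N x r)).

Let mfar x r : measurable (~` cball N x r).
Proof. by apply: measurableC; exact: measurable_cball. Qed.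

Let far01 x r : 0 <= far x r <= 1.
Proof.
rewrite fine_ge0//= -lee_fin fineK; first exact: probability_le1.
by rewrite fin_num_measure.
Qed.

Let far_le x r x' r' : ~` cball N x r `<=` ~` cball N x' r' -> far x r <= far x' r'.
Proof.
by move=> h; apply: fine_le; rewrite ?fin_num_measure// le_measure ?inE.
Qed.

(** If the minimum exceeds [s], all [q] points of the block lie outside the ball of radius [sqrt s],
    and these events are independent with equal probability. *)
Lemma min_sqdist_tail x o q s : (0 < q)%N -> 0 < s ->
  (P [set w | (s < min_sqdist x o q w)%R] <= (far x (Num.sqrt s) ^+ q)%:E)%E.
Proof.
move=> q0 s0; rewrite -(iid_power o q iidX' (mfar _ _)).
have m1 : measurable [set w | s < min_sqdist x o q w].
  rewrite (_ : [set w | _] = min_sqdist x o q @^-1` `]s, +oo[%classic).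
    rewrite -[X in measurable X]setTI.
    exact: (measurable_min_sqdist (x := fun=> x) (w := id)).
  by apply/seteqP; split => w; rewrite /= in_itv/= andbT.
apply: le_measure; rewrite ?inE//.
  apply: fin_bigcap_measurable => // j _.
  by rewrite -[X in measurable X]setTI; exact: measurable_funP.
move=> w /= /bigmin_gtP[_ h] j /=; rewrite mem_iota => /andP[oj jq].
have jo : (j - o < q)%N by rewrite ltn_subLR.
have := h (Ordinal jo) isT; rewrite /= subnKC// => sj.
rewrite /cball/=; apply/negP; rewrite -ltNge.
have Nj := is_norm_ge0 normN (x - X' j w).
by rewrite -[ltRHS](ger0_norm Nj) -sqrtr_sqr ltr_sqrt// (lt_trans s0).
Qed.

Context (m0 : nat) (m0_gt0 : (0 < m0)%N).
Hypothesis momX' : (\int[P]_w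
  (\big[Num.min/N (X' 0%N w)]_(j < m0) N (X' j w))%:E < +oo)%E.

Let M := fine (\int[P]_w (\big[Num.min/N (X' 0%N w)]_(j < m0) N (X' j w))%:E)%E.

(** Markov's inequality: when the first [m0] points all avoid the ball of radius [r] around 0, their
    least norm is at least [r]. *)
Let far0 r : 0 < r -> far 0 r ^+ m0 <= M / r.
Proof.
move=> r0; rewrite ler_pdivlMr// mulrC -lee_fin EFinM.
pose Z w := \big[Num.min/N (X' 0%N w)]_(j < m0) N (X' j w).
have Z0 w : 0 <= Z w by apply: le_bigmin => [|j _]; exact: is_norm_ge0.
have mN j : measurable_fun setT (fun w => N (X' j w)).
  by apply: (measurableT_comp (measurable_is_norm normN)).
have mZ : measurable_fun setT Z by exact: measurable_bigmin.
rewrite -(iid_power 0 m0 iidX' (mfar _ _)) /M fineK; last first.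
  rewrite ge0_fin_numE//; apply: integral_ge0 => w _; rewrite lee_fin.
  exact: Z0.
set A := \bigcap_(_ in _) _.
have mA : measurable A.
  apply: fin_bigcap_measurable => // j _.
  by rewrite -[X in measurable X]setTI; exact: measurable_funP.
rewrite -[A]setIT -integral_indic// -ge0_integralZl_EFin//; last 2 first.
- by apply/measurable_EFinP; exact/measurable_indicP.
- exact: ltW.
apply: ge0_le_integral => //.
- by move=> w _; rewrite lee_fin mulr_ge0// ltW.
- by apply/measurable_EFinP/measurable_funM => //; exact/measurable_indicP.
- exact/measurable_EFinP.
move=> w _; rewrite lee_fin indicE; have [wA|wA] := boolP (w \in A); last first.
  by rewrite mulr0; exact: Z0.
rewrite mulr1; move: wA; rewrite inE => wA.
have wr j : (j < m0)%N -> r <= N (X' j w).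
  move=> jm; have := wA j; rewrite /= mem_iota/= add0n => /(_ jm).
  by rewrite /cball/= sub0r (is_normN normN) => /negP; rewrite -ltNge => /ltW.
by apply: le_bigmin => [|j _]; exact: wr.
Qed.

Context (U : set 'rV[R]_d) (p : 'rV[R]_d -> R) (p_gt0 : forall x, U x -> 0 < p x).
Context (kappa r_kappa : R) (kappa_gt0 : 0 < kappa) (r_kappa_gt0 : 0 < r_kappa).
Hypothesis lower_ball : forall x r, U x -> 0 <= r <= r_kappa ->
  ((kappa * p x * unit_ball_volume N * r ^+ d)%:E <= mu (cball N x r))%E.

(** The tail bound of [tail_power_bound], taken with [g = far x] and [lam] proportional to [p x], is
    integrated by [ge0_expectation_tail]. The constant is independent of the point, of the block and
    of its size. *)
Lemma min_sqdist_bound : exists2 C, 0 <= C & forall x o q, U x -> (4 * m0 * 2 <= q)%N ->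
  (\int[P]_w (min_sqdist x o q w)%:E <=
   (C * ((1 + N x ^+ 2) / p x `^ (2 / d%:R)) / q%:R `^ (2 / d%:R))%:E)%E.
Proof.
pose kv := kappa * unit_ball_volume N.
have v0 := unit_ball_volume_gt0 normN.
have kv0 : 0 < kv by rewrite mulr_gt0.
pose W := 16 + 256 * (1 + M ^+ 2) / r_kappa ^+ 2.
have W0 : 0 < W.
  apply: ltr_wpDr; last by rewrite ltr0n.
  apply: mulr_ge0; last by rewrite invr_ge0 sqr_ge0.
  apply: mulr_ge0; first by rewrite ler0n.
  by rewrite addr_ge0 ?sqr_ge0.
have M0 : 0 <= M.
  apply: fine_ge0; apply: integral_ge0 => w _; rewrite lee_fin.
  by apply: le_bigmin => [|j _]; exact: is_norm_ge0.
exists (3 * (W / kv `^ (2 / d%:R))).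
  by rewrite mulr_ge0// divr_ge0 ?powR_ge0// ltW.
move=> x o q Ux qq0.
have q0 : (0 < q)%N by move: m0_gt0 qq0; clear; lia.
have px0 := p_gt0 Ux.
have qr0 : 0 < q%:R :> R by rewrite ltr0n.
have lam0 : 0 < kv * p x by rewrite mulr_gt0.
have Nx0 := is_norm_ge0 normN x.
pose a := W / (q%:R * (kv * p x)) `^ (2 / d%:R) * (1 + N x ^+ 2).
have -> : 3 * (W / kv `^ (2 / d%:R)) * ((1 + N x ^+ 2) / p x `^ (2 / d%:R)) /
    q%:R `^ (2 / d%:R) = 3 * a.
  rewrite /a !powRM ?(ltW qr0) ?(ltW lam0) ?(ltW kappa_gt0) ?(ltW v0) ?(ltW kv0) ?(ltW px0)//.
  by field; rewrite !gt_eqF ?powR_gt0.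
apply: ge0_expectation_tail.
- exact: (measurable_min_sqdist (x := fun=> x) (w := id)).
- by move=> w; exact: min_sqdist_ge0.
- rewrite mulr_gt0 ?divr_gt0 ?powR_gt0 ?mulr_gt0//.
  by rewrite ltr_pwDl// sqr_ge0.
move=> s s0; apply: (le_trans (min_sqdist_tail _ _ _ _)) => //.
(* Each group of [m0] factors decays like [1 / r] by [far0]; four groups give [r ^ -4], that is
   [s ^ -2] for [s = r ^ 2]. *)
rewrite lee_fin; apply: (tail_power_bound d_gt0 (c := M) (q0 := 4 * m0)) => //.
- by move=> r r' rr'; apply: far_le; apply: subsetC => y; rewrite /cball/= => /le_trans; exact.
- move=> r r_rk; rewrite lerBrDr -lerBrDl.
  have -> : 1 - far x r = fine (mu (cball N x r)).
    have mb := measurable_cball normN x r.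
    rewrite /far probability_setC// -(@fineK _ (mu (cball N x r))).
      by rewrite -EFinB /= opprB addrC subrK.
    by rewrite fin_num_measure.
  rewrite -lee_fin fineK ?fin_num_measure//; last exact: measurable_cball.
  apply: le_trans (lower_ball Ux r_rk).
  by rewrite lee_fin le_eqVlt; apply/orP; left; apply/eqP; rewrite /kv; ring.
move=> r r0; have r2 : 0 < r ^+ 2 by rewrite exprn_gt0.
have /andP[f0 f1] := far01 x r.
(* If [r <= 2 * N x], the right-hand side is at least 1. Otherwise the ball of radius [r / 2] around
   0 lies inside the ball of radius [r] around [x], and [far0] applies. *)
have [rx|rx] := leP r (2 * N x).
  apply: (@le_trans _ _ 1); first exact: exprn_ile1.
  apply: exprn_ege1; rewrite ler_pdivlMr// mul1r.
  have := sqr_ge0 M; have := ltW r0; nra.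
have fx : far x r <= far 0 (r / 2).
  apply: far_le => y; rewrite /cball/= sub0r (is_normN normN) => /negP; rewrite -ltNge => ry.
  apply/negP; rewrite -ltNge.
  have := is_normB_triangle normN 0 x y.
  rewrite subr0 sub0r (is_normN normN); lra.
have r20 : 0 < r / 2 by rewrite divr_gt0.
have /andP[f0' _] := far01 0 (r / 2).
have fm : far x r ^+ m0 <= M / (r / 2).
  by apply: le_trans (far0 r20); apply: lerXn2r; rewrite ?nnegrE.
rewrite mulnC exprM; apply: (@le_trans _ _ ((M / (r / 2)) ^+ 4)).
  apply: lerXn2r fm; first by rewrite nnegrE exprn_ge0.
  by rewrite nnegrE divr_ge0// ltW.
rewrite (exprM _ 2 2); apply: lerXn2r; rewrite ?nnegrE ?sqr_ge0//.
  by rewrite divr_ge0 ?(ltW r2)// addr_ge0// mulr_ge0// sqr_ge0.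
rewrite (_ : (M / (r / 2)) ^+ 2 = 4 * M ^+ 2 / r ^+ 2); last by field; rewrite gt_eqF.
by rewrite ler_pM2r ?invr_gt0// lerDr mulr_ge0// sqr_ge0.
Qed.

End nearest_neighbour_distance.

(** * Weights, bias and rates *)

(** Jensen's inequality for the square: the weighted variance around the mean is nonnegative. *)
Lemma sqr_weighted_sum_le (R : realType) (I : finType) (w a : I -> R) :
  (forall i, 0 <= w i) -> \sum_i w i = 1 ->
  (\sum_i w i * a i) ^+ 2 <= \sum_i w i * a i ^+ 2.
Proof.
move=> w0 w1; set mean := \sum_i w i * a i.
have : 0 <= \sum_i w i * (a i - mean) ^+ 2.
  by apply: sumr_ge0 => i _; rewrite mulr_ge0// sqr_ge0.
rewrite (eq_bigr (fun i => w i * a i ^+ 2 + (- (2 * mean) * (w i * a i) + mean ^+ 2 * w i))).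
  by rewrite !big_split/= -!mulr_sumr w1 -/mean; lra.
by move=> i _; ring.
Qed.

Section weights.
Context (R : realType) (d : nat) (N : 'rV[R]_d -> R).
Context (x x' : nat -> 'rV[R]_d) (m n k : nat).
Hypotheses (n_gt0 : (0 < n)%N) (k_gt0 : (0 < k)%N) (km : (k <= m)%N).

(** This is [nn_weight] divided by [m], normalized so that the estimator becomes a weighted mean. *)
Definition nn_avg_weight (j : nat) : R :=
  (k * n)%:R^-1 * \sum_(i < n) nn_select N x' m k (x i) j.

Let kn0 : 0 < (k * n)%:R :> R. Proof. by rewrite ltr0n muln_gt0 k_gt0. Qed.

Lemma nn_avg_weight_ge0 j : 0 <= nn_avg_weight j.
Proof.
rewrite mulr_ge0 ?invr_ge0 ?(ltW kn0)//.
by apply: sumr_ge0 => i _; exact: nn_select_ge0.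
Qed.

Lemma nn_avg_weight_le j : (j < m)%N -> nn_avg_weight j <= k%:R^-1.
Proof.
move=> jm; rewrite /nn_avg_weight ler_pdivrMl//.
have -> : (k * n)%:R / k%:R = n%:R :> R.
  by rewrite natrM mulrAC divff ?mul1r// pnatr_eq0 -lt0n.
have -> : n%:R = \sum_(i < n) 1 :> R by rewrite sumr_const card_ord.
by apply: ler_sum => i _; exact: nn_select_le1.
Qed.

Lemma nn_avg_weight_sum : \sum_(j < m) nn_avg_weight j = 1.
Proof.
rewrite /nn_avg_weight -mulr_sumr exchange_big/= (eq_bigr (fun=> k%:R)).
  rewrite sumr_const card_ord -[_ *+ n]mulr_natr -natrM mulVf// gt_eqF//.
by move=> i _; exact: nn_select_total.
Qed.

(** In each squared weight, one factor is at most [1 / k] and the other is kept to sum to 1. *)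
Lemma nn_avg_weight_sqr_sum (b : nat -> R) (K : R) :
  (forall j, `|b j| <= K) ->
  \sum_(j < m) (nn_avg_weight j * b j) ^+ 2 <= K ^+ 2 / k%:R.
Proof.
move=> bK; rewrite -[leRHS]mulr1 -[X in _ <= _ * X]nn_avg_weight_sum mulr_sumr.
apply: ler_sum => j _; have w0 := nn_avg_weight_ge0 j.
have b2 : b j ^+ 2 <= K ^+ 2.
  by rewrite -real_normK ?num_real// lerXn2r ?nnegrE// (le_trans _ (bK j)).
rewrite exprMn expr2 -mulrA [leRHS]mulrC ler_wpM2l//.
by rewrite [leRHS]mulrC ler_pM ?sqr_ge0// nn_avg_weight_le.
Qed.

Context (psi : 'rV[R]_d -> R) (L : R).
Hypothesis lip : forall y z, `|psi y - psi z| <= L * N (y - z).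

(** The weights [v i j] on pairs have total mass 1, and both terms of the difference are means over
    pairs; Jensen and the Lipschitz bound then apply to the pairwise differences. *)
Lemma nn_bias_sqr_le :
  (n%:R^-1 * \sum_(i < n) psi (x i) - \sum_(j < m) nn_avg_weight j * psi (x' j)) ^+ 2
  <= L ^+ 2 * ((k * n)%:R^-1 *
       \sum_(i < n) \sum_(j < m) nn_select N x' m k (x i) j * N (x i - x' j) ^+ 2).
Proof.
pose v (i : 'I_n) (j : 'I_m) := (k * n)%:R^-1 * nn_select N x' m k (x i) j.
have v0 i j : 0 <= v i j by rewrite mulr_ge0 ?invr_ge0 ?(ltW kn0)// nn_select_ge0.
pose w (ij : 'I_n * 'I_m) := v ij.1 ij.2.
have w0 ij : 0 <= w ij by exact: v0.
have w1 : \sum_ij w ij = 1.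
  rewrite -nn_avg_weight_sum -(pair_bigA _ v)/= exchange_big/=.
  by apply: eq_bigr => j _; rewrite -mulr_sumr.
rewrite [X in X ^+ 2](_ : _ = \sum_ij w ij * (psi (x ij.1) - psi (x' ij.2))).
  apply: (le_trans (sqr_weighted_sum_le _ w0 w1)).
  rewrite pair_bigA/= mulrCA !mulr_sumr; apply: ler_sum => ij _.
  rewrite /w /v -[leLHS]mulrA ler_wpM2l ?invr_ge0 ?(ltW kn0)//.
  rewrite [leRHS]mulrCA ler_wpM2l ?nn_select_ge0//.
  rewrite -exprMn -real_normK ?num_real// lerXn2r ?nnegrE//.
  exact: le_trans (normr_ge0 _) (lip _ _).
have -> : n%:R^-1 * \sum_(i < n) psi (x i) = \sum_ij w ij * psi (x ij.1).
  rewrite -(pair_bigA _ (fun i j => v i j * psi (x i)))/= mulr_sumr.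
  apply: eq_bigr => i _; rewrite -mulr_suml /v -mulr_sumr; congr (_ * _).
  by rewrite nn_select_total// natrM invfM mulrAC mulVf ?mul1r// pnatr_eq0 -lt0n.
have -> : \sum_(j < m) nn_avg_weight j * psi (x' j) = \sum_ij w ij * psi (x' ij.2).
  rewrite -(pair_bigA _ (fun i j => v i j * psi (x' j)))/= exchange_big/=.
  by apply: eq_bigr => j _; rewrite -mulr_suml /v -mulr_sumr.
by rewrite -sumrB; apply: eq_bigr => ij _; rewrite mulrBr.
Qed.
End weights.

(** One nearest point from each of the [k] consecutive blocks of length [q] gives [k] distinct
    indices, and by [nn_select_min] the true neighbours do no worse. *)
Lemma nn_group_bound (R : realType) (d : nat) (N : 'rV[R]_d -> R)
    (normN : is_norm N) dT (T : measurableType dT) (P : probability T R)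
    (X' : nat -> {RV P >-> 'rV[R]_d}) (x : 'rV[R]_d) (w : T) (m k q : nat) :
  (0 < q)%N -> (k * q <= m)%N -> 
  \sum_(j < m) nn_select N (fun j => X' j w) m k x j * N (x - X' j w) ^+ 2 <=
  \sum_(g < k) min_sqdist N X' x (g * q) q w.
Proof.
move=> q0 kqm.
have km : (k <= m)%N by rewrite (leq_trans _ kqm)// leq_pmulr.
pose j (g : nat) := sval (cid (min_sqdist_attained N X' x (g * q) w q0)).
have jP g : N (x - X' (g * q + j g)%N w) ^+ 2 <= min_sqdist N X' x (g * q) q w.
  exact: svalP (cid (min_sqdist_attained N X' x (g * q) w q0)).
have em (g : 'I_k) : (g * q + j g < m)%N.
  apply: (leq_trans _ kqm); apply: (@leq_trans (g.+1 * q)).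
    by rewrite mulSn addnC ltn_add2r.
  by rewrite leq_mul2r ltn_ord orbT.
pose e (g : 'I_k) : 'I_m := Ordinal (em g).
have inje : injective e.
  (* The offset in a block is below [q], so division by [q] recovers the block. *)
  move=> g g' /(congr1 val)/= /(congr1 (divn^~ q)).
  by rewrite !divnMDl// !divn_small// !addn0 => /val_inj.
apply: (le_trans (nn_select_min (F := fun j => N (x - X' j w) ^+ 2) km inje _)).
  move=> i i' ii'; rewrite lerXn2r// nnegrE; exact: is_norm_ge0.
by apply: ler_sum => g _; exact: jP.
Qed.

(** With [gam = beta ^ -2], eventually [k m] is within a factor 2 of [gam]. As the remainder of the
    division is below [k m], [m <= 2 * q * k m], so [m / gam <= 4 * q]; raising this to the power
    [2 / d] gives the last bound. *)
Lemma nn_rate (R : realType) (d : nat) (k : nat -> nat) (Q : nat) :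
  (0 < d)%N -> (forall m, (1 <= m)%N -> (1 <= k m <= m)%N) ->
  (fun m => (k m)%:R / m%:R `^ (2 / (d%:R + 2))) @ \oo --> (1 : R) ->
  exists m1, forall m, (m1 <= m)%N ->
  let beta := (m%:R `^ (d%:R + 2)^-1)^-1 : R in
  [/\ (0 < m)%N, (Q <= m %/ k m)%N, (k m)%:R^-1 <= 2 * beta ^+ 2 &
      ((m %/ k m)%:R `^ (2 / d%:R))^-1 <= 16 * beta ^+ 2].
Proof.
move=> d0 kb k1.
have half0 : 0 < 2^-1 :> R by rewrite invr_gt0.
have [m2 _ hm2] := (@cvgrPdist_lt _ R^o _ _ _ _ _).1 k1 _ half0.
(* The cube works in every dimension: [d / (d + 2) >= 1 / 3], hence [4 * Q <= m ^ (1 / 3) <= m ^ (d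
   / (d + 2)) <= 4 * q]. *)
exists (maxn 1 (maxn m2 ((4 * Q) ^ 3))) => m; rewrite !geq_max => /and3P[m0 m2m Qm] beta.
have /andP[k0 km] := kb m m0.
have d0' : 0 < d%:R :> R by rewrite ltr0n.
have m0' : 1 <= m%:R :> R by rewrite ler1n.
have mgt0 : 0 < m%:R :> R by rewrite ltr0n.
have k0' : 0 < (k m)%:R :> R by rewrite ltr0n.
have d2 : 0 < d%:R + 2 :> R by rewrite addr_gt0.
pose gam := m%:R `^ (2 / (d%:R + 2)) : R.
have gam0 : 0 < gam by rewrite powR_gt0.
have bE : beta ^+ 2 = gam^-1.
  rewrite /beta exprVn -powR_mulrn ?powR_ge0// -powRrM; congr (_ `^ _)^-1.
  by rewrite mulrC.
have := hm2 m m2m; rewrite /= -/gam ltr_norml => /andP[kl ku].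
have kge : gam / 2 <= (k m)%:R.
  have : 2^-1 <= (k m)%:R / gam by lra.
  by rewrite ler_pdivlMr// mulrC.
have kle : (k m)%:R <= 2 * gam.
  have : (k m)%:R / gam <= 2 by lra.
  by rewrite ler_pdivrMr.
set q := (m %/ k m)%N.
have q0 : (0 < q)%N by rewrite divn_gt0.
have q0' : 0 < q%:R :> R by rewrite ltr0n.
have mq : m%:R <= 2 * q%:R * (k m)%:R :> R.
  rewrite -!natrM ler_nat {1}(divn_eq m (k m)) -/q mul2n -addnn mulnDl leq_add2l.
  by rewrite ltnW// (leq_trans (ltn_pmod _ k0))// leq_pmull.
have q4 : m%:R `^ (d%:R / (d%:R + 2)) <= 4 * q%:R :> R.
  have -> : m%:R `^ (d%:R / (d%:R + 2)) = m%:R / gam.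
    rewrite /gam -{2}(powRr1 (ltW mgt0)) -powRB.
      by congr (_ `^ _); field; rewrite gt_eqF.
    by rewrite (gt_eqF mgt0) implybT.
  rewrite ler_pdivrMr//; have := ler_wpM2l (ltW q0') kle; nra.
split => //.
- rewrite -(ler_nat R) -(ler_pM2l (_ : 0 < 4))//.
  apply: le_trans q4; rewrite (@le_trans _ _ (m%:R `^ 3^-1))//.
    have Q4 : 0 <= 4 * Q%:R :> R by rewrite mulr_ge0.
    have -> : 4 * Q%:R = ((4 * Q%:R) `^ 3%:R) `^ 3^-1 :> R.
      by rewrite -powRrM divff// powRr1.
    apply: ge0_ler_powR; rewrite ?nnegrE ?powR_ge0//.
    by rewrite powR_mulrn// -natrM -natrX ler_nat.
  apply: ler_powR => //; rewrite ler_pdivlMr// mulrC ler_pdivrMr//.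
  have d1 : 1 <= d%:R :> R by rewrite ler1n.
  by lra.
- rewrite bE -[leLHS]mul1r ler_pdivrMr// mulrAC ler_pdivlMr// mul1r.
  by lra.
have g16 : gam <= 16 * q%:R `^ (2 / d%:R).
  have -> : gam = (m%:R `^ (d%:R / (d%:R + 2))) `^ (2 / d%:R).
    rewrite -powRrM; congr (_ `^ _); field.
    by rewrite !gt_eqF.
  rewrite (@le_trans _ _ ((4 * q%:R) `^ (2 / d%:R)))//.
    by apply: ge0_ler_powR; rewrite ?nnegrE ?powR_ge0.
  rewrite powRM ?(ltW q0')//; apply: ler_wpM2r; first exact: powR_ge0.
  rewrite (@le_trans _ _ (4 `^ 2%:R))//.
    apply: ler_powR; first by rewrite ler1n.
    by rewrite ler_pdivrMr// ler_pMr// ler1n.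
  by rewrite powR_mulrn//; lra.
rewrite bE -[leLHS]mul1r ler_pdivrMr ?powR_gt0// mulrAC ler_pdivlMr// mul1r.
by lra.
Qed.

(** * Decomposition of the quadratic risk *)

Section bounded_expectation.
Local Open Scope ereal_scope.
Context dY (TY : measurableType dY) (R : realType) (nu : probability TY R).
Context (g : TY -> R) (K : R).
Hypotheses (mg : measurable_fun setT g) (gK : forall y, (`|g y| <= K)%R).

Lemma bounded_centered :
  \int[nu]_y (g y - fine (\int[nu]_y (g y)%:E))%:E = 0.
Proof.
have ig := bounded_integrable nu mg gK.
under eq_integral do rewrite EFinB.
rewrite integralB//; last exact: finite_measure_integrable_cst.
rewrite integral_cst//= probability_setT mule1 fineK ?integrable_fin_num//.
by rewrite subee// integrable_fin_num.
Qed.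

Lemma bounded_expectation_le : (`|fine (\int[nu]_y (g y)%:E)| <= K)%R.
Proof.
have ig := bounded_integrable nu mg gK.
rewrite -lee_fin -fine_abse ?integrable_fin_num// fineK; last first.
  by rewrite abse_fin_num integrable_fin_num.
apply: (le_trans (le_abse_integral _ _ _)) => //; first exact/measurable_EFinP.
apply: (@le_trans _ _ (\int[nu]_y (cst K%:E y))); last first.
  by rewrite integral_cst//= probability_setT mule1.
apply: ge0_le_integral => //.
  by apply/measurable_EFinP; exact: measurableT_comp.
by move=> y _; rewrite lee_fin.
Qed.

Lemma bounded_integral_law dT (T : measurableType dT) (P : probability T R)
    (Y : {RV P >-> TY}) :
  has_law Y nu -> \int[P]_t (g (Y t))%:E = \int[nu]_y (g y)%:E.
Proof.
move=> lY; rewrite -(@integral_distribution _ _ _ _ _ P Y (EFin \o g))//.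
- by apply: eq_measure_integral => A mA _; exact: lY.
- exact/measurable_EFinP.
- apply: (@bounded_integrable _ _ _ _ (g \o Y) K) => //.
    exact: measurableT_comp.
  by move=> t; exact: gK.
Qed.

End bounded_expectation.

Section orthogonality.
Local Open Scope ereal_scope.
Context dT (T : measurableType dT) (R : realType) (P : probability T R).
Context dY (TY : measurableType dY) (Y : T -> TY) (mu : probability TY R).
Hypothesis mY : measurable_fun setT Y.
Context (G : set_system T).
Hypotheses (GI : setI_closed G) (Gm : G `<=` measurable) (GT : G setT).
Hypothesis indep : forall A B, G A -> measurable B ->
  P (A `&` Y @^-1` B) = P A * mu B.

Lemma integral_freeze_mul0 (u : g_sigma_algebraType G -> R)
    (v : g_sigma_algebraType G * TY -> R) (K K' : R) :
  measurable_fun setT u -> measurable_fun setT v ->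
  (forall t, `|u t| <= K)%R -> (forall z, `|v z| <= K')%R ->
  (forall t, \int[mu]_y (v (t, y))%:E = 0) ->
  \int[P]_t (u t * v (t, Y t))%:E = 0.
Proof.
move=> mu_ mv uK vK v0.
apply: (@bounded_integral_freeze0 _ _ _ P _ _ Y mu mY G GI Gm GT indep
  (fun z => u z.1 * v z)%R (K * K')%R).
- by apply: measurable_funM => //; exact: measurableT_comp.
- by move=> z; rewrite normrM ler_pM.
- move=> t; under eq_integral do rewrite EFinM/=.
  rewrite integralZl//; first by rewrite v0 mule0.
  by apply: (@bounded_integrable _ _ _ _ _ K') => //; exact: measurableT_comp.
Qed.

End orthogonality.

Lemma measurable_nn_avg_weight (R : realType) (d : nat) (N : 'rV[R]_d -> R)
    (normN : is_norm N) dS (S : measurableType dS) (x x' : nat -> S -> 'rV[R]_d)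
    (m n k j : nat) :
  (forall i, measurable_fun setT (x i)) -> (forall i, measurable_fun setT (x' i)) ->
  measurable_fun setT (fun s => nn_avg_weight N (x ^~ s) (x' ^~ s) m n k j).
Proof.
move=> mx mx'; apply: measurable_funM => //.
by apply: measurable_sum => i; exact: measurable_nn_select.
Qed.

Section samples.
Context (R : realType) (d : nat) (N : 'rV[R]_d -> R) (normN : is_norm N).
Context dTh (Th : measurableType dTh) (F : 'rV[R]_d -> Th -> R) (M : R).
Hypotheses (mF : measurable_fun setT (fun z : 'rV[R]_d * Th => F z.1 z.2))
  (FM : forall x th, `|F x th| <= M).
Context (mu_X : probability 'rV[R]_d R) (mu_Th : probability Th R).
Context dT (T : measurableType dT) (P : probability T R).
Context (Xs X's : nat -> {RV P >-> 'rV[R]_d}) (Ths : nat -> {RV P >-> Th}).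
Hypotheses (iidX : iid Xs mu_X) (iidTh : iid Ths mu_Th).
Hypothesis indep_samples : mutually_independent P
  (tnth [tuple sigma_rv_seq Xs; sigma_rv_seq X's; sigma_rv_seq Ths]).

(** With [F x th = phi (f x th)] this is the function [psi], expressed through the law of the
    noise. *)
Definition cond_mean (x : 'rV[R]_d) : R := fine (\int[mu_Th]_th (F x th)%:E)%E.

Let mFc dS (S : measurableType dS) (x : S -> 'rV[R]_d) (th : S -> Th) :
  measurable_fun setT x -> measurable_fun setT th ->
  measurable_fun setT (fun s => F (x s) (th s)).
Proof.
move=> mx mth.
have h : measurable_fun setT
    ((fun z : 'rV[R]_d * Th => F z.1 z.2) \o (fun s => (x s, th s))).
  by apply: measurableT_comp => //; exact: measurable_fun_pair.
exact: h.
Qed.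

Let mFx x : measurable_fun setT (F x).
Proof. exact: (measurableT_comp mF (measurable_pair1 x)). Qed.

Lemma cond_mean_le x : `|cond_mean x| <= M.
Proof. by apply: bounded_expectation_le => // th. Qed.

(** Tonelli gives measurability of the partial integral of the nonnegative function [F + M];
    subtracting [M] returns to [F]. *)
Lemma measurable_cond_mean : measurable_fun setT cond_mean.
Proof.
have FM0 z : (0 <= (F z.1 z.2 + M)%:E)%E.
  by rewrite lee_fin; have := FM z.1 z.2; rewrite ler_norml; lra.
have mFM : measurable_fun setT (fun z : 'rV[R]_d * Th => (F z.1 z.2 + M)%:E).
  by apply/measurable_EFinP; exact: measurable_funD.
have := measurable_fun_fubini_tonelli_F (m2 := mu_Th) _ mFM FM0.
move=> mI; rewrite (_ : cond_mean =
    (fun x => fine (\int[mu_Th]_th (F x th + M)%:E)%E - M)).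
  apply: measurable_funB => //.
  exact: (measurableT_comp (@fine_measurable R setT measurableT) mI).
apply/funext => x; have iF := bounded_integrable mu_Th (mFx x) (FM x).
have If := integrable_fin_num measurableT iF.
have -> : (\int[mu_Th]_th (F x th + M)%:E = \int[mu_Th]_th (F x th)%:E + M%:E)%E.
  under eq_integral do rewrite EFinD.
  rewrite integralD//; last exact: finite_measure_integrable_cst.
  by rewrite integral_cst//= probability_setT mule1.
rewrite /cond_mean; move: If => /=.
by case: (\int[mu_Th]_th (F x th)%:E)%E => [r|//|//] _ /=; rewrite addrK.
Qed.

Let eps x th := cond_mean x - F x th.

Let eps_le x th : `|eps x th| <= 2 * M.
Proof.
rewrite (le_trans (ler_normB _ _))//; have := cond_mean_le x; have := FM x th; lra.
Qed.

Let meps dS (S : measurableType dS) (x : S -> 'rV[R]_d) (th : S -> Th) :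
  measurable_fun setT x -> measurable_fun setT th ->
  measurable_fun setT (fun s => eps (x s) (th s)).
Proof.
move=> mx mth; apply: measurable_funB.
  exact: (measurableT_comp measurable_cond_mean mx).
exact: mFc.
Qed.

Let eps0 x : (\int[mu_Th]_th (eps x th)%:E = 0)%E.
Proof.
have := bounded_centered mu_Th (mFx x) (FM x).
rewrite -/(cond_mean x) => h.
transitivity (\int[mu_Th]_th ((-1)%:E * (F x th - cond_mean x)%:E))%E.
  by apply: eq_integral => th _; rewrite -EFinM mulN1r opprB.
rewrite integralZl//; first by rewrite h mule0.
apply: (@bounded_integrable _ _ _ _ (fun th => F x th - cond_mean x) (2 * M)).
  exact: measurable_funB.
by move=> th; rewrite distrC; exact: eps_le.
Qed.

Lemma expectation_cond_mean (X : {RV P >-> 'rV[R]_d}) (Theta : {RV P >-> Th}) :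
  has_law X mu_X -> has_law Theta mu_Th ->
  mutually_independent P (tnth [tuple sigma_rv X; sigma_rv Theta]) ->
  (\int[P]_w (F (X w) (Theta w))%:E = \int[mu_X]_x (cond_mean x)%:E)%E.
Proof.
move=> lX lTh ind.
have mX : measurable_fun setT (X : g_sigma_algebraType (sigma_rv X) -> 'rV[R]_d).
  by apply: measurable_rv_sub; exact: sub_sigma_algebra.
(* Freezing [X] leaves the centred variable [eps], whose mean over the noise is 0; the constant
   factor 1 fits the product form of the lemma. *)
have h0 : (\int[P]_w (1 * eps (X w) (Theta w))%:E = 0)%E.
  apply: (@integral_freeze_mul0 _ _ _ P _ _ Theta mu_Th _ (sigma_rv X) _ _ _ _
    (cst 1) (fun z => eps (X z.1) z.2) 1 (2 * M)) => //.
  - exact: sigma_rvI.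
  - exact: sigma_rv_measurable.
  - exact: sigma_rvT.
  - move=> A B XA mB.
    rewrite (mutually_independent2 (i := ord0) (j := ord_max) ind)//; last first.
      exact: sigma_rv_preimage.
    by congr (_ * _)%E; exact: lTh.
  - by apply: meps => //; exact: measurableT_comp.
  - by move=> t; rewrite normr1.
  - by move=> t; exact: (eps0 (X t)).
have iF : P.-integrable setT (fun w => (F (X w) (Theta w))%:E).
  apply: (@bounded_integrable _ _ _ _ (fun w => F (X w) (Theta w)) M) => //.
  exact: mFc.
have ic : P.-integrable setT (fun w => (cond_mean (X w))%:E).
  apply: (@bounded_integrable _ _ _ _ (fun w => cond_mean (X w)) M) => //.
    exact: (measurableT_comp measurable_cond_mean).
  by move=> w; exact: cond_mean_le.
rewrite -(bounded_integral_law measurable_cond_mean cond_mean_le lX).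
move: h0; under eq_integral do rewrite mul1r EFinB.
have fc := integrable_fin_num measurableT ic.
have fF := integrable_fin_num measurableT iF.
rewrite integralB//; move: fc fF.
case: (\int[P]_w (cond_mean (X w))%:E)%E => // r _.
case: (\int[P]_w (F (X w) (Theta w))%:E)%E => // s _ [rs].
by congr EFin; lra.
Qed.

Let QI := fine (\int[mu_X]_x (cond_mean x)%:E)%E.

Let QI_le : `|QI| <= M.
Proof. exact: bounded_expectation_le measurable_cond_mean cond_mean_le. Qed.

Let dev_le x : `|cond_mean x - QI| <= 2 * M.
Proof. by rewrite (le_trans (ler_normB _ _))//; have := cond_mean_le x; have := QI_le; lra. Qed.

Let M2 (a b : R) : `|a| <= b -> a ^+ 2 <= b ^+ 2.
Proof.
by move=> ab; rewrite -real_normK ?num_real// lerXn2r ?nnegrE// (le_trans _ ab).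
Qed.

Lemma sampling_variance n : (0 < n)%N ->
  (\int[P]_w ((QI - n%:R^-1 * \sum_(i < n) cond_mean (Xs i w)) ^+ 2)%:E
   <= ((2 * M) ^+ 2 / n%:R)%:E)%E.
Proof.
move=> n_gt0; have n0 : 0 < n%:R :> R by rewrite ltr0n.
pose Z (i : 'I_n) w := cond_mean (Xs i w) - QI.
have mZ i : measurable_fun setT (Z i).
  apply: measurable_funB => //.
  exact: (measurableT_comp measurable_cond_mean).
have ZM i w : `|Z i w| <= 2 * M by exact: dev_le.
have orthZ i j : i != j -> (\int[P]_w (Z i w * Z j w)%:E = 0)%E.
  move=> ij.
  apply: (@integral_freeze_mul0 _ _ _ P _ _ (Xs j) mu_X _ (sigma_rv (Xs i)) _ _ _ _
    (fun w => cond_mean (Xs i w) - QI) (fun z => cond_mean z.2 - QI) (2 * M) (2 * M)) => //.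
  - exact: sigma_rvI.
  - exact: sigma_rv_measurable.
  - exact: sigma_rvT.
  - move=> A B XA mB.
    rewrite (mutually_independent2 (i := i : nat) (j := j : nat) iidX.2)//.
      by congr (_ * _)%E; exact: iidX.1.
    exact: sigma_rv_preimage.
  - apply: measurable_funB => //; apply: (measurableT_comp measurable_cond_mean).
    by apply: measurable_rv_sub; exact: sub_sigma_algebra.
  - by apply: measurable_funB => //; exact: (measurableT_comp measurable_cond_mean).
  - by move=> t; exact: (bounded_centered mu_X measurable_cond_mean cond_mean_le).
have -> : (\int[P]_w ((QI - n%:R^-1 * \sum_(i < n) cond_mean (Xs i w)) ^+ 2)%:E =
    \int[P]_w ((n%:R^-1 ^+ 2)%:E * ((\sum_i Z i w) ^+ 2)%:E))%E.
  apply: eq_integral => w _; rewrite -EFinM -exprMn /Z sumrB sumr_const card_ord.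
  by congr EFin; rewrite -mulr_natr; field; rewrite gt_eqF.
rewrite ge0_integralZl_EFin//; last 2 first.
- by move=> w _; rewrite lee_fin sqr_ge0.
- by apply/measurable_EFinP/measurable_funX/measurable_sum.
rewrite (integral_sqr_sum_orthogonal mZ ZM orthZ).
apply: (@le_trans _ _ ((n%:R^-1 ^+ 2)%:E * \sum_(i < n) ((2 * M) ^+ 2)%:E)%E).
  apply: lee_wpmul2l; first by rewrite lee_fin sqr_ge0.
  apply: lee_sum => i _.
  apply: (@le_trans _ _ (\int[P]_w (cst ((2 * M) ^+ 2)%:E w))%E).
    apply: ge0_le_integral => //.
    - by move=> w _; rewrite lee_fin sqr_ge0.
    - by apply/measurable_EFinP/measurable_funX.
    - by move=> w _; rewrite lee_fin M2.
  by rewrite integral_cst//= probability_setT mule1.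
rewrite sumEFin sumr_const card_ord -EFinM lee_fin -[_ *+ n]mulr_natr le_eqVlt.
by apply/orP; left; apply/eqP; field; rewrite gt_eqF.
Qed.

Let Wt m n k j w := nn_avg_weight N (fun i => Xs i w) (fun j => X's j w) m n k j.

(** The weights depend on the points alone, so once all points and the noise of index [i] are
    frozen, the term of index [j] has mean 0. The cross terms vanish and the squared weights
    remain. *)
Lemma noise_bound m n k : (0 < n)%N -> (0 < k)%N -> (k <= m)%N ->
  (\int[P]_w ((\sum_(j < m) Wt m n k j w *
      (cond_mean (X's j w) - F (X's j w) (Ths j w))) ^+ 2)%:E
   <= ((2 * M) ^+ 2 / k%:R)%:E)%E.
Proof.
move=> n_gt0 k_gt0 km; have k0 : 0 < k%:R :> R by rewrite ltr0n.
have W0 j w : 0 <= Wt m n k j w by exact: nn_avg_weight_ge0.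
have W1 j w : (j < m)%N -> `|Wt m n k j w| <= 1.
  move=> jm; rewrite ger0_norm// (le_trans (nn_avg_weight_le _ _ _ _ _ _ _))//.
  by rewrite invf_le1// ler1n.
have M0 : 0 <= 2 * M by rewrite mulr_ge0// (le_trans _ QI_le).
pose Z (j : 'I_m) w := Wt m n k j w * eps (X's j w) (Ths j w).
have mW j : measurable_fun setT (Wt m n k j) by exact: measurable_nn_avg_weight.
have mZ j : measurable_fun setT (Z j).
  by apply: measurable_funM; [exact: mW|exact: meps].
have ZM j w : `|Z j w| <= 2 * M.
  by rewrite normrM -[leRHS]mul1r ler_pM// ?W1.
have orthZ i j : i != j -> (\int[P]_w (Z i w * Z j w)%:E = 0)%E.
  move=> ij.
  (* All the sampled points, together with the noise of index [i]. *)
  pose G := [set A | exists A1 A2 A3, [/\ sigma_rv_seq Xs A1, sigma_rv_seq X's A2,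
    sigma_rv (Ths i) A3 & A = A1 `&` A2 `&` A3]].
  have GX l : sigma_rv (Xs l) `<=` <<s G >>.
    move=> A XA; apply: sub_sigma_algebra; exists A, setT, setT; rewrite !setIT.
    split => //; [exact: sub_sigma_rv_seq XA|exact: sigma_rv_seqT|exact: sigma_rvT].
  have GX' l : sigma_rv (X's l) `<=` <<s G >>.
    move=> A XA; apply: sub_sigma_algebra; exists setT, A, setT; rewrite setIT setTI.
    split => //; [exact: sigma_rv_seqT|exact: sub_sigma_rv_seq XA|exact: sigma_rvT].
  have GTh : sigma_rv (Ths i) `<=` <<s G >>.
    move=> A XA; apply: sub_sigma_algebra; exists setT, setT, A; rewrite !setTI.
    by split => //; exact: sigma_rv_seqT.
  pose S := g_sigma_algebraType G.
  have mX l : measurable_fun setT (Xs l : S -> 'rV[R]_d) by exact: measurable_rv_sub.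
  have mX' l : measurable_fun setT (X's l : S -> 'rV[R]_d) by exact: measurable_rv_sub.
  have mTh : measurable_fun setT (Ths i : S -> Th) by exact: measurable_rv_sub.
  have mWS l : measurable_fun setT (Wt m n k l : S -> R).
    exact: measurable_nn_avg_weight.
  pose u (w : S) := Wt m n k i w * Wt m n k j w * eps (X's i w) (Ths i w).
  pose v (z : S * Th) := eps (X's j z.1) z.2.
  transitivity (\int[P]_w (u w * v (w, Ths j w))%:E)%E.
    by apply: eq_integral => w _; congr EFin; rewrite /Z /u /v/=; ring.
  apply: (@integral_freeze_mul0 _ _ _ P _ _ (Ths j) mu_Th _ G _ _ _ _
    u v (2 * M) (2 * M)) => //.
  - move=> _ _ [A1 [A2 [A3 [hA1 hA2 hA3 ->]]]] [B1 [B2 [B3 [hB1 hB2 hB3 ->]]]].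
    exists (A1 `&` B1), (A2 `&` B2), (A3 `&` B3).
    split; [exact: sigma_rv_seqI|exact: sigma_rv_seqI|exact: sigma_rvI|].
    by rewrite setIACA (setIACA A1 A2 B1).
  - move=> _ [A1 [A2 [A3 [hA1 hA2 hA3 ->]]]]; apply: measurableI.
      by apply: measurableI; [exact: sigma_rv_seq_measurable hA1|
        exact: sigma_rv_seq_measurable hA2].
    exact: sigma_rv_measurable hA3.
  - exists setT, setT, setT; rewrite !setIT.
    by split => //; [exact: sigma_rv_seqT|exact: sigma_rv_seqT|exact: sigma_rvT].
  - move=> _ B [A1 [A2 [A3 [hA1 hA2 hA3 ->]]]] mB.
    have hB := sigma_rv_preimage (Ths j) mB.
    have hA3' := sub_sigma_rv_seq hA3.
    have hB' := sub_sigma_rv_seq hB.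
    pose i0 : 'I_3 := Ordinal (isT : (0 < 3)%N).
    pose i1 : 'I_3 := Ordinal (isT : (1 < 3)%N).
    pose i2 : 'I_3 := Ordinal (isT : (2 < 3)%N).
    have ind3 := @mutually_independent3 _ _ _ P _ _ i0 i1 i2 A1 A2 _ indep_samples
      isT isT isT hA1 hA2.
    (* The events of indices [i] and [j] are first merged into one event of the noise sequence,
       separated there from the points, and only then split by independence within that sequence. *)
    rewrite -setIA (ind3 _ (sigma_rv_seqI hA3' hB')) (ind3 _ hA3').
    rewrite (mutually_independent2 iidTh.2 (i := i : nat) (j := j : nat) _ hA3 hB)//.
    by rewrite muleA; congr (_ * _)%E; exact: iidTh.1.
  - by apply: measurable_funM; [exact: measurable_funM|exact: meps].
  - by apply: meps => //; exact: measurableT_comp.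
  - move=> w; rewrite -[leRHS]mul1r /u normrM ler_pM//.
    by rewrite normrM -[leRHS]mul1r ler_pM// W1.
  - by move=> z; exact: eps_le.
  - by move=> w; exact: (eps0 (X's j w)).
rewrite (integral_sqr_sum_orthogonal mZ ZM orthZ).
(* The sum returns under the integral, because the bound [1 / k] holds for the sum of squared
   weights and not term by term. *)
rewrite -ge0_integral_sum//; last 2 first.
- by move=> j; apply/measurable_EFinP/measurable_funX.
- by move=> j w _; rewrite lee_fin sqr_ge0.
apply: (@le_trans _ _ (\int[P]_w (cst ((2 * M) ^+ 2 / k%:R)%:E w))%E); last first.
  by rewrite integral_cst//= probability_setT mule1.
apply: ge0_le_integral => //.
- by move=> w _; apply: sume_ge0 => j _; rewrite lee_fin sqr_ge0.
- by apply: emeasurable_sum => j; apply/measurable_EFinP/measurable_funX.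
move=> w _; rewrite sumEFin lee_fin /Z.
apply: (nn_avg_weight_sqr_sum _ _ _ n_gt0 k_gt0 km (b := fun j => eps (X's j w) (Ths j w))).
by move=> j; exact: eps_le.
Qed.

(** The centre [Xs i] is independent of the whole sequence [X's], so it can be integrated last; for
    almost every value of the centre the bound at a fixed point applies. *)
Lemma random_center_bound i o q (V : 'rV[R]_d -> R) (c v : R) :
  0 <= c -> measurable_fun setT V -> (forall x, 0 <= V x) ->
  (\int[mu_X]_x (V x)%:E <= v%:E)%E ->
  {ae mu_X, forall x, (\int[P]_w (min_sqdist N X's x o q w)%:E <= (c * V x)%:E)%E} ->
  (\int[P]_w (min_sqdist N X's (Xs i w) o q w)%:E <= (c * v)%:E)%E.
Proof.
move=> c0 mV V0 Vv aeV.
pose G := sigma_rv_seq X's.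
have mX' j : measurable_fun setT (X's j : g_sigma_algebraType G -> 'rV[R]_d).
  by apply: measurable_rv_sub => A XA; apply: sub_sigma_algebra; exact: sub_sigma_rv_seq XA.
have Z0 x w : (0 <= (min_sqdist N X's x o q w)%:E)%E.
  by rewrite lee_fin; exact: min_sqdist_ge0.
have mZ : measurable_fun setT
    (fun z : g_sigma_algebraType G * 'rV[R]_d => (min_sqdist N X's z.2 o q z.1)%:E).
  apply/measurable_EFinP; apply: (measurable_min_sqdist normN) => // j.
  exact: measurableT_comp.
have -> := @ge0_integral_freeze_swap _ _ _ P _ _ (Xs i) mu_X _ G _ _ _ _
  (fun z => (min_sqdist N X's z.2 o q z.1)%:E) mZ (fun z => Z0 _ _); last 5 first.
- exact: measurable_funP.
- exact: sigma_rv_seqI.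
- exact: sigma_rv_seq_measurable.
- exact: sigma_rv_seqT.
- move=> A B GA mB.
  pose i0 : 'I_3 := Ordinal (isT : (0 < 3)%N).
  pose i1 : 'I_3 := Ordinal (isT : (1 < 3)%N).
  have hB := sub_sigma_rv_seq (sigma_rv_preimage (Xs i) mB).
  rewrite (@mutually_independent2 _ _ _ P _ _ i1 i0 A _ indep_samples isT GA hB).
  by congr (_ * _)%E; exact: iidX.1.
have mZ' : measurable_fun setT
    (fun z : T * 'rV[R]_d => (min_sqdist N X's z.2 o q z.1)%:E).
  apply/measurable_EFinP; apply: (measurable_min_sqdist normN) => // j.
  exact: measurableT_comp.
apply: (@le_trans _ _ (\int[mu_X]_x (c * V x)%:E)%E).
  apply: ae_ge0_le_integral => //.
  - by move=> x _; exact: integral_ge0.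
  - exact: (measurable_fun_fubini_tonelli_G (m1 := P) _ mZ' (fun z => Z0 _ _)).
  - by move=> x _; rewrite lee_fin mulr_ge0.
  - by apply/measurable_EFinP; exact: measurable_funM.
  - by apply: filterS aeV => x + _.
under eq_integral do rewrite EFinM.
rewrite ge0_integralZl_EFin//; last 2 first.
- by move=> x _; rewrite lee_fin.
- exact/measurable_EFinP.
by rewrite EFinM; apply: lee_wpmul2l; rewrite ?lee_fin.
Qed.

(** The bias is bounded pathwise by the block distances. Each of the [k * n] terms has expectation
    at most [c * v], and their number cancels the normalization. *)
Lemma bias_bound m n k q (L : R) (V : 'rV[R]_d -> R) (c v : R) :
  (0 < n)%N -> (0 < k)%N -> (0 < q)%N -> (k * q <= m)%N ->
  (forall x y, `|cond_mean x - cond_mean y| <= L * N (x - y)) ->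
  0 <= c -> measurable_fun setT V -> (forall x, 0 <= V x) ->
  (\int[mu_X]_x (V x)%:E <= v%:E)%E ->
  {ae mu_X, forall x, forall o,
    (\int[P]_w (min_sqdist N X's x o q w)%:E <= (c * V x)%:E)%E} ->
  (\int[P]_w ((n%:R^-1 * \sum_(i < n) cond_mean (Xs i w) -
     \sum_(j < m) Wt m n k j w * cond_mean (X's j w)) ^+ 2)%:E
   <= (L ^+ 2 * (c * v))%:E)%E.
Proof.
move=> n_gt0 k_gt0 q_gt0 kqm lip c0 mV V0 Vv aeV.
have km : (k <= m)%N by rewrite (leq_trans _ kqm)// leq_pmulr.
have kn0 : 0 < (k * n)%:R :> R by rewrite ltr0n muln_gt0 k_gt0.
pose D w : R := \sum_(i < n) \sum_(g < k) min_sqdist N X's (Xs i w) (g * q) q w.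
have mD : measurable_fun setT D.
  apply: measurable_sum => i; apply: measurable_sum => g.
  by apply: (measurable_min_sqdist normN).
have D0 w : 0 <= D w.
  by apply: sumr_ge0 => i _; apply: sumr_ge0 => g _; exact: min_sqdist_ge0.
have a0 : 0 <= L ^+ 2 / (k * n)%:R by rewrite divr_ge0 ?sqr_ge0.
apply: (@le_trans _ _ (\int[P]_w ((L ^+ 2 / (k * n)%:R)%:E * (D w)%:E))%E).
  apply: ge0_le_integral => //.
  - by move=> w _; rewrite lee_fin sqr_ge0.
  - apply/measurable_EFinP/measurable_funX/measurable_funB.
      apply: measurable_funM => //; apply: measurable_sum => i.
      exact: (measurableT_comp measurable_cond_mean).
    apply: measurable_sum => j; apply: measurable_funM.
      exact: measurable_nn_avg_weight.
    exact: (measurableT_comp measurable_cond_mean).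
  - by apply/measurable_EFinP; exact: measurable_funM.
  move=> w _; rewrite lee_fin.
  apply: (le_trans (nn_bias_sqr_le (fun i => Xs i w) (fun j => X's j w) n_gt0 k_gt0 km lip)).
  rewrite mulrA ler_wpM2l//; apply: ler_sum => i _.
  exact: nn_group_bound.
rewrite ge0_integralZl_EFin//; last 2 first.
- by move=> w _; rewrite lee_fin.
- exact/measurable_EFinP.
have -> : (L ^+ 2 * (c * v))%:E =
    ((L ^+ 2 / (k * n)%:R)%:E * \sum_(i < n) \sum_(g < k) (c * v)%:E)%E.
  under eq_bigr do rewrite sumEFin sumr_const card_ord.
  rewrite sumEFin sumr_const card_ord -mulrnA -EFinM -[_ *+ (k * n)]mulr_natr.
  by congr EFin; field; rewrite !pnatr_eq0 -!lt0n k_gt0 n_gt0.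
apply: lee_wpmul2l; first by rewrite lee_fin.
rewrite /D; under eq_integral do rewrite -sumEFin.
rewrite ge0_integral_sum//; last 2 first.
- move=> i; apply/measurable_EFinP/measurable_sum => g.
  by apply: (measurable_min_sqdist normN).
- by move=> i w _; rewrite lee_fin; apply: sumr_ge0 => g _; exact: min_sqdist_ge0.
apply: lee_sum => i _; under eq_integral do rewrite -sumEFin.
rewrite ge0_integral_sum//; last 2 first.
- by move=> g; apply/measurable_EFinP; apply: (measurable_min_sqdist normN).
- by move=> g w _; rewrite lee_fin; exact: min_sqdist_ge0.
apply: lee_sum => g _; apply: (random_center_bound _ c0 mV V0 Vv).
by apply: filterS aeV => x; exact.
Qed.

Lemma risk_bound m n k q (L : R) (V : 'rV[R]_d -> R) (c v : R) :
  (0 < n)%N -> (0 < k)%N -> (0 < q)%N -> (k * q <= m)%N ->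
  (forall x y, `|cond_mean x - cond_mean y| <= L * N (x - y)) ->
  0 <= c -> measurable_fun setT V -> (forall x, 0 <= V x) ->
  (\int[mu_X]_x (V x)%:E <= v%:E)%E ->
  {ae mu_X, forall x, forall o,
    (\int[P]_w (min_sqdist N X's x o q w)%:E <= (c * V x)%:E)%E} ->
  (\int[P]_w (`|fine (\int[mu_X]_x (cond_mean x)%:E)%E -
     \sum_(j < m) Wt m n k j w * F (X's j w) (Ths j w)| ^+ 2)%:E
   <= (3 * ((2 * M) ^+ 2 / n%:R + L ^+ 2 * (c * v) + (2 * M) ^+ 2 / k%:R))%:E)%E.
Proof.
move=> n_gt0 k_gt0 q_gt0 kqm lip c0 mV V0 Vv aeV; rewrite -/QI.
have km : (k <= m)%N by rewrite (leq_trans _ kqm)// leq_pmulr.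
pose A w := QI - n%:R^-1 * \sum_(i < n) cond_mean (Xs i w).
pose B w := n%:R^-1 * \sum_(i < n) cond_mean (Xs i w) -
  \sum_(j < m) Wt m n k j w * cond_mean (X's j w).
pose C w := \sum_(j < m) Wt m n k j w *
  (cond_mean (X's j w) - F (X's j w) (Ths j w)).
have mW j : measurable_fun setT (Wt m n k j) by exact: measurable_nn_avg_weight.
have mc (X : {RV P >-> 'rV[R]_d}) : measurable_fun setT (fun w => cond_mean (X w)).
  exact: (measurableT_comp measurable_cond_mean).
have mavg : measurable_fun setT (fun w => n%:R^-1 * \sum_(i < n) cond_mean (Xs i w)).
  by apply: measurable_funM => //; apply: measurable_sum.
have mA : measurable_fun setT A by exact: measurable_funB.
have mB : measurable_fun setT B.
  apply: measurable_funB => //; apply: measurable_sum => j.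
  by apply: measurable_funM; [exact: mW|exact: mc].
have mC : measurable_fun setT C.
  by apply: measurable_sum => j; apply: measurable_funM; [exact: mW|exact: meps].
have ABC w : QI - \sum_(j < m) Wt m n k j w * F (X's j w) (Ths j w) = A w + B w + C w.
  rewrite (_ : C w = \sum_(j < m) Wt m n k j w * cond_mean (X's j w) -
      \sum_(j < m) Wt m n k j w * F (X's j w) (Ths j w)); last first.
    by rewrite -sumrB; apply: eq_bigr => j _; rewrite mulrBr.
  by rewrite /A /B; ring.
under eq_integral do rewrite ABC.
apply: (@le_trans _ _ (\int[P]_w (3%:E * ((A w ^+ 2)%:E + (B w ^+ 2)%:E + (C w ^+ 2)%:E)))%E).
  apply: ge0_le_integral => //.
  - apply/measurable_EFinP/measurable_funX.
    by apply: measurableT_comp => //; do 2 apply: measurable_funD => //.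
  - apply/measurable_EFinP; apply: measurable_funM => //.
    by apply: measurable_funD; [apply: measurable_funD|]; exact: measurable_funX.
  (* The inequality [(a + b + c) ^ 2 <= 3 * (a ^ 2 + b ^ 2 + c ^ 2)] follows from the squares of the
     three differences. *)
  move=> w _; rewrite lee_fin real_normK ?num_real//.
  have := sqr_ge0 (A w - B w); have := sqr_ge0 (B w - C w); have := sqr_ge0 (A w - C w).
  by move: (A w) (B w) (C w) => a b c'; nra.
have ge0sqr (Z : T -> R) w : (0 <= (Z w ^+ 2)%:E)%E by rewrite lee_fin sqr_ge0.
have mA2 : measurable_fun setT (fun w => (A w ^+ 2)%:E) by apply/measurable_EFinP/measurable_funX.
have mB2 : measurable_fun setT (fun w => (B w ^+ 2)%:E) by apply/measurable_EFinP/measurable_funX.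
have mC2 : measurable_fun setT (fun w => (C w ^+ 2)%:E) by apply/measurable_EFinP/measurable_funX.
rewrite ge0_integralZl_EFin//; last 2 first.
- by move=> w _; rewrite !adde_ge0.
- by do 2 apply: emeasurable_funD => //.
rewrite ge0_integralD//; last 2 first.
- by move=> w _; rewrite adde_ge0.
- exact: emeasurable_funD.
rewrite ge0_integralD// EFinM; apply: lee_wpmul2l => //.
rewrite !EFinD; apply: leeD; last exact: noise_bound.
by apply: leeD; [exact: sampling_variance|exact: (bias_bound n_gt0 k_gt0 q_gt0 kqm lip c0 mV V0 Vv aeV)].
Qed.

End samples.

(** * Choice of constants and rate of the quadratic risk *)

Theorem proposition4p6 (R : realType) (d e : nat) (d_gt0 : (0 < d)%N)
  (N : 'rV[R]_d -> R) (normN : is_norm N)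
  (dT : measure_display) (Theta_space : measurableType dT)
  (f : 'rV[R]_d -> Theta_space -> 'rV[R]_e) (phi : 'rV[R]_e -> R)
  (mf : measurable_fun setT (fun z : 'rV[R]_d * Theta_space => f z.1 z.2))
  (mphi : measurable_fun setT phi)
  (mu_X mu_X' : probability 'rV[R]_d R) (mu_Theta : probability Theta_space R)
  (dO : measure_display) (Omega : measurableType dO) (P : probability Omega R)
  (X : {RV P >-> 'rV[R]_d}) (Theta : {RV P >-> Theta_space})
  (lawX : has_law X mu_X) (lawTheta : has_law Theta mu_Theta)
  (indepXTheta : mutually_independent P
     (tnth [tuple sigma_rv X; sigma_rv Theta]))
  (Xs X's : nat -> {RV P >-> 'rV[R]_d}) (Thetas : nat -> {RV P >-> Theta_space})
  (iidX : iid Xs mu_X) (iidX' : iid X's mu_X') (iidTheta : iid Thetas mu_Theta)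
  (indep_samples : mutually_independent P
     (tnth [tuple sigma_rv_seq Xs; sigma_rv_seq X's; sigma_rv_seq Thetas]))
  (tau : nat -> R) (tau_ge0 : forall n, (1 <= n)%N -> 0 <= tau n)
  (tauO : exists (C : R) (n0 : nat), forall n, (n0 <= n)%N ->
     (\int[P]_w W1 N mu_X (empirical n (fun i => Xs i w))
        <= (C * tau n)%:E)%E)
  (* (i) *)
  (bphi : bounded_fun phi)
  (* (ii) *)
  (lip_psi : exists L : R, forall x y,
     `|fine ('E_P[fun w => phi (f x (Theta w))])%E
       - fine ('E_P[fun w => phi (f y (Theta w))])%E| <= L * N (x - y))
  (* (iii) *)
  (momX : ('E_P[(fun w => N (X w) ^+ 2)%R] < +oo)%E)
  (* (iv) *)
  (momX' : exists2 m0 : nat, (1 <= m0)%N &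
     ('E_P[(fun w => \big[Num.min/N (X's 0%N w)]_(j < m0) N (X's j w))%R] < +oo)%E)
  (* (v) *)
  (U : set 'rV[R]_d) (openU : open U) (suppU : supp N mu_X `<=` U)
  (p : 'rV[R]_d -> R)
  (density_p : is_density (lebesgue_rV R d) (fun A => mu_X' (A `&` U)) p)
  (cont_p : {within U, continuous p}) (p_gt0 : forall x, U x -> 0 < p x)
  (kappa r_kappa : R) (kappa_gt0 : 0 < kappa) (kappa_le1 : kappa <= 1)
  (r_kappa_gt0 : 0 < r_kappa)
  (lower_ball : forall x r, U x -> 0 <= r <= r_kappa ->
     ((kappa * p x * unit_ball_volume N * r ^+ d)%:E <= mu_X' (cball N x r))%E)
  (* (vi) *)
  (mom_density :
     ('E_P[(fun w => (1 + N (X w) ^+ 2) / p (X w) `^ (2 / d%:R))%R] < +oo)%E)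
  (k : nat -> nat) (k_bounds : forall m, (1 <= m)%N -> (1 <= k m <= m)%N)
  (k_mono : forall m m', (1 <= m)%N -> (m <= m')%N -> (k m <= k m')%N)
  (k_equiv : (fun m => (k m)%:R / m%:R `^ (2 / (d%:R + 2))) @ \oo --> (1 : R)) :
  let QI := fine ('E_P[fun w => phi (f (X w) (Theta w))])%E in
  let QIhat m n w := nn_estimator N (fun i => Xs i w) (fun j => X's j w)
        (fun j => phi (f (X's j w) (Thetas j w))) m n (k m) in
  exists (C1 C2 : R) (m1 n1 : nat), forall m n, (m1 <= m)%N -> (n1 <= n)%N ->
    (('E_P[(fun w => `|QI - QIhat m n w| ^+ 2)%R]) `^ 2^-1
     <= (C1 * ((Num.sqrt n%:R)^-1 + tau n)
         + C2 * (m%:R `^ (d%:R + 2)^-1)^-1)%:E)%E.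
Proof.
move=> QI QIhat.
pose F x th := phi (f x th).
have mF : measurable_fun setT (fun z : 'rV[R]_d * Theta_space => F z.1 z.2).
  exact: measurableT_comp.
have [M FM] : exists M, forall x th, `|F x th| <= M.
  (* Boundedness provides every constant strictly above [M0], hence the shift by 1. *)
  by have [M0 [_ hM]] := bphi; exists (M0 + 1) => x th; apply: hM => //; rewrite ltrDl.
have mFx x : measurable_fun setT (F x).
  exact: (measurableT_comp mF (measurable_pair1 x)).
have psiE x : fine ('E_P[fun w => phi (f x (Theta w))])%E = cond_mean F mu_Theta x.
  rewrite unlock; congr fine.
  exact: (bounded_integral_law (nu := mu_Theta) (mFx x) (FM x) lawTheta).
have [L lip] := lip_psi.
have {}lip x y : `|cond_mean F mu_Theta x - cond_mean F mu_Theta y| <= L * N (x - y).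
  by rewrite -!psiE.
have QIE : QI = fine (\int[mu_X]_x (cond_mean F mu_Theta x)%:E)%E.
  rewrite /QI unlock; congr fine.
  exact: (expectation_cond_mean mF FM lawX lawTheta indepXTheta).
have [m0 m0_gt0 momX'E] := momX'; rewrite unlock in momX'E.
have [C C0 distC] := min_sqdist_bound d_gt0 normN iidX' m0_gt0 momX'E p_gt0
  kappa_gt0 r_kappa_gt0 lower_ball.
pose V x := (1 + N x ^+ 2) / p x `^ (2 / d%:R).
have V0 x : 0 <= V x by rewrite divr_ge0 ?powR_ge0// addr_ge0// sqr_ge0.
have mV : measurable_fun setT V.
  have -> : V = (fun x => (1 + N x ^+ 2) * p x `^ (- (2 / d%:R))).
    by apply/funext => x; rewrite powRN.
  have [mp _ _] := density_p.
  apply: measurable_funM.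
    by apply: measurable_funD => //; apply: measurable_funX; exact: measurable_is_norm.
  exact: (measurableT_comp (measurable_powR _) mp).
pose v := fine (\int[mu_X]_x (V x)%:E)%E.
have Vv : (\int[mu_X]_x (V x)%:E = v%:E)%E.
  rewrite fineK// ge0_fin_numE; last by apply: integral_ge0 => x _; rewrite lee_fin.
  rewrite -(integral_law lawX)//; last exact/measurable_EFinP.
  by move: mom_density; rewrite unlock.
have v0 : 0 <= v by apply: fine_ge0; apply: integral_ge0 => x _; rewrite lee_fin.
have [m1 rate] := nn_rate (4 * m0 * 2) d_gt0 k_bounds k_equiv.
(* The factors 16 and 2 come from [nn_rate]: 16 turns [q ^ (- 2 / d)] into [beta ^ 2] in the bias,
   and 2 does so for [1 / k m] in the noise. *)
pose c2 := 3 * (L ^+ 2 * (16 * C * v) + 2 * (2 * M) ^+ 2).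
have c20 : 0 <= c2.
  by rewrite mulr_ge0// addr_ge0// mulr_ge0 ?sqr_ge0// !mulr_ge0.
exists (Num.sqrt (3 * (2 * M) ^+ 2)), (Num.sqrt c2), m1, 1%N => m n m1m n_gt0.
have [m_gt0 Qq rk rq] := rate m m1m.
set beta := (_ `^ _)^-1 in rk rq *.
have /andP[k_gt0 km] := k_bounds m m_gt0.
set q := (m %/ k m)%N in Qq rq.
have q_gt0 : (0 < q)%N by rewrite divn_gt0.
have kqm : (k m * q <= m)%N by rewrite mulnC leq_trunc_div.
have beta0 : 0 <= beta by rewrite invr_ge0 powR_ge0.
have qa0 : 0 < q%:R `^ (2 / d%:R) :> R by rewrite powR_gt0 ?ltr0n.
pose c := C / q%:R `^ (2 / d%:R).
have c0 : 0 <= c by rewrite divr_ge0// ltW.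
have aeV : {ae mu_X, forall x, forall o,
    (\int[P]_w (min_sqdist N X's x o q w)%:E <= (c * V x)%:E)%E}.
  (* Almost every [x] is in the support, hence in [U], where the bound holds for all blocks at
     once. *)
  apply: filterS (supp_ae normN mu_X) => x /suppU Ux o.
  by have := distC x o q Ux Qq; rewrite mulrAC.
have Vv' : (\int[mu_X]_x (V x)%:E <= v%:E)%E by rewrite Vv.
have risk := risk_bound normN mF FM iidX iidTheta indep_samples n_gt0 k_gt0 q_gt0
  kqm lip c0 mV V0 Vv' aeV.
have n0 : 0 < n%:R :> R by rewrite ltr0n.
set a := Num.sqrt (3 * (2 * M) ^+ 2).
set b := Num.sqrt c2.
have a0 : 0 <= a by exact: sqrtr_ge0.
have b0 : 0 <= b by exact: sqrtr_ge0.
have sn0 : 0 <= (Num.sqrt n%:R)^-1 :> R by rewrite invr_ge0 sqrtr_ge0.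
(* The squares of [a] and [b] are the coefficients of [1 / n] and [beta ^ 2] in the risk; the cross
   term of the square is nonnegative, so the root can be taken afterwards. *)
have bound : ('E_P[(fun w => `|QI - QIhat m n w| ^+ 2)%R] <=
    ((a * (Num.sqrt n%:R)^-1 + b * beta) ^+ 2)%:E)%E.
  rewrite unlock.
  have -> : (\int[P]_w (`|QI - QIhat m n w| ^+ 2)%:E =
    \int[P]_w (`|fine (\int[mu_X]_x (cond_mean F mu_Theta x)%:E)%E -
     \sum_(j < m) nn_avg_weight N (fun i => Xs i w) (fun j => X's j w) m n (k m) j
       * F (X's j w) (Thetas j w)| ^+ 2)%:E)%E.
    by apply: eq_integral => w _; rewrite QIE /QIhat nn_estimatorE.
  apply: (le_trans risk); rewrite lee_fin.
  have a2 : a ^+ 2 = 3 * (2 * M) ^+ 2 by rewrite sqr_sqrtr// mulr_ge0// sqr_ge0.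
  have b2 : b ^+ 2 = c2 by rewrite sqr_sqrtr.
  have s2 : (Num.sqrt n%:R)^-1 ^+ 2 = n%:R^-1 :> R by rewrite exprVn sqr_sqrtr// ltW.
  rewrite sqrrD [(a * _) ^+ 2]exprMn [(b * _) ^+ 2]exprMn a2 b2 s2.
  have cross : 0 <= (a * (Num.sqrt n%:R)^-1 * (b * beta)) *+ 2.
    by rewrite mulrn_wge0// !mulr_ge0.
  have h1 : L ^+ 2 * (c * v) <= L ^+ 2 * (16 * C * v) * beta ^+ 2.
    rewrite -[leRHS]mulrA ler_wpM2l ?sqr_ge0// [leRHS]mulrAC ler_wpM2r//.
    by rewrite /c [16 * C]mulrC -[leRHS]mulrA ler_wpM2l.
  have h2 : (2 * M) ^+ 2 / (k m)%:R <= 2 * (2 * M) ^+ 2 * beta ^+ 2.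
    by rewrite [2 * _ ^+ 2]mulrC -[leRHS]mulrA ler_wpM2l// sqr_ge0.
  rewrite /c2; lra.
have tau0 : 0 <= a * tau n by rewrite mulr_ge0// tau_ge0.
apply: (@le_trans _ _ ((a * (Num.sqrt n%:R)^-1 + b * beta)%:E)); last first.
  by rewrite lee_fin mulrDr lerD2r lerDl.
have s0 : 0 <= a * (Num.sqrt n%:R)^-1 + b * beta by rewrite addr_ge0// mulr_ge0.
apply: (@le_trans _ _ (((a * (Num.sqrt n%:R)^-1 + b * beta) ^+ 2)%:E `^ 2^-1)%E).
  apply: gt0_ler_poweR => //.
  - by rewrite in_itv/= leey andbT expectation_ge0// => w; exact: exprn_ge0.
  - by rewrite in_itv/= leey andbT lee_fin sqr_ge0.
by rewrite poweR_EFin powR12_sqrt ?sqr_ge0// sqrtr_sqr ger0_norm.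
Qed.
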